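(* Let $R$ be a field of characteristic $0$, and let $\mathscr{C}$ be a category such that $\mathscr{C}^{\mathrm{op}}$ is a type II combinatorial category satisfying the left Ore condition and satisfying, over $R$, the conditions (LN), (LS) and (NV). Equip $\mathscr{C}$ with the atomic topology to get a site $\boldsymbol{\mathscr{C}}$. Then the Nakayama functor $\nu$ induces equivalences $$\mathrm{sh}(\boldsymbol{\mathscr{C}}, R) \simeq \mathscr{C}^{\mathrm{op}}\text{-mod} / \mathscr{C}^{\mathrm{op}}\text{-mod}^{\mathrm{tor}} \simeq \mathscr{C}^{\mathrm{op}}\text{-mod}^{\mathrm{fd}},$$ where $\mathscr{C}^{\mathrm{op}}\text{-mod}^{\mathrm{fd}}$ is the category of finite dimensional $\mathscr{C}^{\mathrm{op}}$-modules.
   Context: Write $\mathscr{D} = \mathscr{C}^{\mathrm{op}}$. A $\mathscr{D}$-module is a covariant functor from $\mathscr{D}$ to $R$-vector spaces; $V_x$ is the value of $V$ at $x$. $P(x) = R\mathscr{D}(x,-)$ is the $R$-linearized representable functor. $\mathscr{D}$ is a type II combinatorial category if: it is a small skeletal category that is EI (every endomorphism is an isomorphism); every morphism is a monomorphism; $|\mathscr{D}(x,y)| < \infty$ for all objects $x,y$; and for every object $x$ the set $\{ y \mid \mathscr{D}(y,x) \neq \emptyset\}$ is finite. Left Ore condition: any two morphisms $f: x\to y$, $f': x \to y'$ in $\mathscr{D}$ admit $g: y\to z$, $g': y'\to z$ with $gf = g'f'$. A $\mathscr{D}$-module $V$ is torsion if for every object $x$ and $v \in V_x$ there is a morphism $f: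 x\to y$ with $V(f)(v) = 0$. A $\mathscr{D}$-module is finitely generated if it is a quotient of a finite direct sum of modules $P(x)$. It is finite dimensional if $\sum_x \dim_R V_x < \infty$. (LN): every finitely generated $\mathscr{D}$-module is Noetherian. (LS): every projective $\mathscr{D}$-module is also injective. (NV): for every finitely generated $\mathscr{D}$-module $V$ which is not torsion there is an object $x$ such that $\mathrm{Hom}(V, P(x)) \neq 0$. $\mathscr{D}\text{-mod}$ is the (abelian, by (LN)) category of finitely generated $\mathscr{D}$-modules, $\mathscr{D}\text{-mod}^{\mathrm{tor}}$ its full subcategory of torsion modules, and the quotient is the Serre quotient. The atomic topology on $\mathscr{C}$ is the one whose covering sieves are all nonempty sieves; presheaves of $R$-modules on $\mathscr{C}$ are the same as $\mathscr{D}$-modules. $\mathrm{sh}(\boldsymbol{\mathscr{C}}, R)$ is the full subcategory of finitely generated $\mathscr{D}$-modules whose underlying presheaf of sets on $\mathscr{C}$ is a sheaf for the atomic topology. The Nakayama functor is $$\nu: \mathscr{D}\text{-mod} \to \mathscr{D}\text{-mod}^{\mathrm{fd}}, \quad V \mapsto D\Big(\mathrm{Hom}_{\mathscr{D}\text{-mod}}\big(V, \bigoplus_{x} P(x)\big)\Big), \quad D = \mathrm{Hom}_R(-, R),$$ so that $(\nu V)_x = D\,\mathrm{Hom}(V, P(x))$, with a morphism $f: x\to y$ acting via the map $P(y) \to P(x)$ given by precomposition with $f$. *)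

(* Defs.v *)
From HB Require Import structures.
From mathcomp Require Import all_boot all_order all_algebra.
From mathcomp Require Import boolp classical_sets cardinality.

Set Implicit Arguments.
Unset Strict Implicit.
Unset Printing Implicit Defensive.

Import GRing.Theory.
Local Open Scope ring_scope.

(* The index categories of module categories are the separate type fincat *)
(* below: they are small, whereas a module category is large, and category is *)
(* universe monomorphic. *)
Record category := Category {
  cob :> Type;
  arr : cob -> cob -> Type;
  ida : forall x, arr x x;
  acomp : forall x y z, arr y z -> arr x y -> arr x z;
  acomp1m : forall x y (f : arr x y), acomp (ida y) f = f;
  acompm1 : forall x y (f : arr x y), acomp f (ida x) = f;
  acompA : forall x y z w (h : arr z w) (g : arr y z) (f : arr x y),
    acomp h (acomp g f) = acomp (acomp h g) f
}.
Arguments arr {c} x y.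
Arguments ida {c} x.
Arguments acomp {c x y z} g f.

Notation "g \oc f" := (acomp g f) (at level 40, left associativity).

Definition is_iso (A : category) (x y : A) (f : arr x y) : Prop :=
  exists g : arr y x, g \oc f = ida x /\ f \oc g = ida y.

Record functor (A B : category) := Functor {
  fob :> A -> B;
  fmap : forall x y : A, arr x y -> arr (fob x) (fob y);
  fmap1 : forall x : A, fmap (ida x) = ida (fob x);
  fmapM : forall (x y z : A) (g : arr y z) (f : arr x y),
    fmap (g \oc f) = fmap g \oc fmap f
}.
Arguments fmap {A B} _ {x y} _.

Definition idfunctor (A : category) : functor A A :=
  @Functor A A (fun x => x) (fun x y f => f)
    (fun x => erefl) (fun x y z g f => erefl).

Lemma functor_comp1 (A B E : category) (G : functor B E) (F : functor A B)
  (x : A) : fmap G (fmap F (ida x)) = ida (G (F x)).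
Proof. by rewrite !fmap1. Qed.

Lemma functor_compM (A B E : category) (G : functor B E) (F : functor A B)
  (x y z : A) (g : arr y z) (f : arr x y) :
  fmap G (fmap F (g \oc f)) = fmap G (fmap F g) \oc fmap G (fmap F f).
Proof. by rewrite !fmapM. Qed.

Definition functor_comp (A B E : category) (G : functor B E) (F : functor A B) :
  functor A E :=
  @Functor A E (fun x => G (F x)) (fun x y f => fmap G (fmap F f))
    (functor_comp1 G F) (functor_compM G F).

Definition nat_iso (A B : category) (F G : functor A B) : Prop :=
  exists t : forall x : A, arr (F x) (G x),
    (forall x, is_iso (t x)) /\
    (forall (x y : A) (f : arr x y), t y \oc fmap F f = fmap G f \oc t x).

Definition is_equivalence (A B : category) (F : functor A B) : Prop :=
  exists G : functor B A,
    nat_iso (functor_comp G F) (idfunctor A) /\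
    nat_iso (functor_comp F G) (idfunctor B).

Definition fullsub (A : category) (P : A -> Prop) : category :=
  @Category {x : A | P x} (fun x y => @arr A (sval x) (sval y))
    (fun x => ida (sval x)) (fun x y z g f => g \oc f)
    (fun x y f => acomp1m f) (fun x y f => acompm1 f)
    (fun x y z w h g f => acompA h g f).

Definition incl (A : category) (P : A -> Prop) : functor (fullsub P) A :=
  @Functor (fullsub P) A (fun x => sval x) (fun x y f => f)
    (fun x => erefl) (fun x y z g f => erefl).

Definition corestrict (A B : category) (P : B -> Prop) (F : functor A B)
  (FP : forall x, P (F x)) : functor A (fullsub P) :=
  @Functor A (fullsub P) (fun x => exist P (F x) (FP x)) (fun x y f => fmap F f)
    (fun x => fmap1 F x) (fun x y z g f => fmapM F g f).

Section Fractions.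
Variable A : category.

Record square (W : forall X Y : A, arr X Y -> Prop) (X Y Z : A)
  (f : arr X Y) (s : arr Z Y) := Square {
  sq_ob : A;
  sq_l : arr sq_ob X;
  sq_r : arr sq_ob Z;
  sq_W : W _ _ sq_l;
  sq_comm : f \oc sq_l = s \oc sq_r
}.

Record calculus := Calculus {
  weak : forall X Y : A, arr X Y -> Prop;
  weak_id : forall X : A, weak (ida X);
  weak_comp : forall (X Y Z : A) (t : arr Y Z) (s : arr X Y),
    weak t -> weak s -> weak (t \oc s);
  weak_square : forall (X Y Z : A) (f : arr X Y) (s : arr Z Y),
    weak s -> square weak f s;
  weak_cancel : forall (X Y Z : A) (f g : arr X Y) (s : arr Y Z),
    weak s -> s \oc f = s \oc g ->
    exists (T : A) (t : arr T X), weak t /\ f \oc t = g \oc t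
}.

Variable W : calculus.

(* A roof X <-den- apex -num-> Y represents the fraction num \oc den^-1. *)
Record roof (X Y : A) := Roof {
  apex : A;
  den : arr apex X;
  num : arr apex Y;
  den_weak : weak W den
}.

Definition roof_eqv (X Y : A) (r r' : roof X Y) : Prop :=
  exists (T : A) (a : arr T (apex r)) (b : arr T (apex r')),
    [/\ den r \oc a = den r' \oc b, num r \oc a = num r' \oc b
      & weak W (den r \oc a)].

Lemma roof_eqv_refl X Y (r : roof X Y) : roof_eqv r r.
Proof.
by exists (apex r), (ida _), (ida _); split=> //; rewrite acompm1; exact: den_weak.
Qed.

Lemma roof_eqv_sym X Y (r r' : roof X Y) : roof_eqv r r' -> roof_eqv r' r.
Proof. by move=> [T [a [b [e1 e2 w]]]]; exists T, b, a; split=> //; rewrite -e1. Qed.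

Lemma roof_eqv_trans X Y (r1 r2 r3 : roof X Y) :
  roof_eqv r1 r2 -> roof_eqv r2 r3 -> roof_eqv r1 r3.
Proof.
move=> [T [a [b [e1 e2 w]]]] [T' [a' [b' [e1' e2' w']]]].
have w2 : weak W (den r2 \oc b) by rewrite -e1.
have [U u v wu euv] := weak_square (den r2 \oc a') w2.
have [U' [t [wt et]]] : exists U' (t : arr U' U), weak W t /\
    (b \oc v) \oc t = (a' \oc u) \oc t.
  by apply: (weak_cancel (den_weak r2)); rewrite !acompA.
exists U', (a \oc v \oc t), (b' \oc u \oc t); split.
- rewrite !acompA e1 -e1'.
  by rewrite -euv.
- by rewrite !acompA e2 -e2' -!acompA; congr (_ \oc _); rewrite !acompA.
- rewrite !acompA e1 -euv.
  by apply: weak_comp wt; apply: weak_comp wu.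
Qed.

Definition roof_id (X : A) : roof X X := Roof (ida X) (weak_id W X).

Definition roof_comp (X Y Z : A) (q : roof Y Z) (r : roof X Y) : roof X Z :=
  let S := weak_square (num r) (den_weak q) in
  Roof (num q \oc sq_r S) (weak_comp (den_weak r) (sq_W S)).

Lemma roof_comp_eqvl X Y Z (q : roof Y Z) (r1 r2 : roof X Y) :
  roof_eqv r1 r2 -> roof_eqv (roof_comp q r1) (roof_comp q r2).
Proof.
move=> [T [a [b [e1 e2 w]]]]; rewrite /roof_comp.
case: (weak_square (num r1) _) => U1 p1 p1' w1 c1.
case: (weak_square (num r2) _) => U2 p2 p2' w2 c2 /=.
have [B t1 k1 wt1 d1] := weak_square a w1.
have [B' t2 k2 wt2 d2] := weak_square (b \oc t1) w2.
have [B2 [t3 [wt3 d3]]] : exists B2 (t3 : arr B2 B'), weak W t3 /\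
    (p1' \oc k1 \oc t2) \oc t3 = (p2' \oc k2) \oc t3.
  apply: (weak_cancel (den_weak q)); rewrite !acompA -c1 -c2.
  by rewrite -[num r2 \oc _ \oc _]acompA -d2 -[num r1 \oc _ \oc _]acompA -d1 !acompA e2.
exists B2, (k1 \oc t2 \oc t3), (k2 \oc t3); split=> /=.
- rewrite !acompA -[den r1 \oc _ \oc _]acompA -d1 acompA e1.
  by rewrite -[den r2 \oc p2 \oc _]acompA -d2 !acompA.
- by rewrite -!acompA; congr (_ \oc _); rewrite !acompA.
- rewrite !acompA -[den r1 \oc _ \oc _]acompA -d1 acompA.
  by do !apply: weak_comp => //.
Qed.

Lemma roof_comp_eqvr X Y Z (q1 q2 : roof Y Z) (r : roof X Y) :
  roof_eqv q1 q2 -> roof_eqv (roof_comp q1 r) (roof_comp q2 r).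
Proof.
move=> [T [a [b [e1 e2 w]]]]; rewrite /roof_comp.
case: (weak_square (num r) (den_weak q1)) => U1 p1 p1' w1 c1.
case: (weak_square (num r) (den_weak q2)) => U2 p2 p2' w2 c2 /=.
have [B1 t1 k wt1 d1] := weak_square (num r \oc p1) w.
have [B2 [t2 [wt2 d2]]] : exists B2 (t2 : arr B2 B1), weak W t2 /\
    (p1' \oc t1) \oc t2 = (a \oc k) \oc t2.
  by apply: (weak_cancel (den_weak q1)); rewrite !acompA -c1 d1.
have [B3 t3 k2 wt3 d3] := weak_square (p1 \oc t1 \oc t2) w2.
have [B4 [t4 [wt4 d4]]] : exists B4 (t4 : arr B4 B3), weak W t4 /\
    (p2' \oc k2) \oc t4 = (b \oc k \oc t2 \oc t3) \oc t4.
  apply: (weak_cancel (den_weak q2)); rewrite !acompA -c2 -e1 -d1.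
  by rewrite -[num r \oc _ \oc _]acompA -d3 !acompA.
exists B4, (t1 \oc t2 \oc t3 \oc t4), (k2 \oc t4); split=> /=.
- by rewrite !acompA -[den r \oc p2 \oc _]acompA -d3 !acompA.
- rewrite -[num q2 \oc _ \oc _]acompA [p2' \oc _]acompA d4 !acompA -e2.
  rewrite -[num q1 \oc _ \oc _]acompA -[num q1 \oc _ \oc _]acompA d2.
  by rewrite !acompA.
- have wr := den_weak r.
  by rewrite !acompA; do !apply: weak_comp => //.
Qed.

Lemma roof_comp1m X Y (r : roof X Y) : roof_eqv (roof_comp (roof_id Y) r) r.
Proof.
rewrite /roof_comp; case: (weak_square _ _) => U p p' w /= c.
exists U, (ida U), p; rewrite !acompm1; split=> //.
by apply: weak_comp => //; exact: den_weak.
Qed.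

Lemma roof_compm1 X Y (r : roof X Y) : roof_eqv (roof_comp r (roof_id X)) r.
Proof.
rewrite /roof_comp; case: (weak_square _ _) => U p p' w /= c.
by exists U, (ida U), p'; rewrite /= !acompm1 acomp1m; split=> //; rewrite -c acomp1m.
Qed.

Lemma roof_compA X Y Z V (w : roof Z V) (q : roof Y Z) (r : roof X Y) :
  roof_eqv (roof_comp w (roof_comp q r)) (roof_comp (roof_comp w q) r).
Proof.
rewrite /roof_comp.
case: (weak_square (num r) (den_weak q)) => U p p' wp c1 /=.
case: (weak_square (num q \oc p') (den_weak w)) => S al al' wal c2 /=.
case: (weak_square (num q) (den_weak w)) => B be be' wbe c3 /=.
case: (weak_square (num r) _) => E ep ep' wep c4 /=; rewrite /= in c4 *.
have [F t1 k wt1 d1] := weak_square ep (weak_comp wp wal).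
have [F2 [t2 [wt2 d2]]] : exists F2 (t2 : arr F2 F), weak W t2 /\
    (p' \oc al \oc k) \oc t2 = (be \oc ep' \oc t1) \oc t2.
  apply: (weak_cancel (den_weak q)); rewrite !acompA -c1 -c4.
  by rewrite -[num r \oc ep \oc _]acompA d1 !acompA.
have [F3 [t3 [wt3 d3]]] : exists F3 (t3 : arr F3 F2), weak W t3 /\
    (al' \oc k \oc t2) \oc t3 = (be' \oc ep' \oc t1 \oc t2) \oc t3.
  apply: (weak_cancel (den_weak w)); rewrite !acompA -c2 -c3.
  have := congr1 (acomp (num q)) d2; rewrite !acompA => ->.
  by [].
exists F3, (k \oc t2 \oc t3), (t1 \oc t2 \oc t3); split=> /=.
- rewrite !acompA -[den r \oc ep \oc _]acompA d1.
  by rewrite !acompA.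
- have := congr1 (acomp (num w)) d3; rewrite !acompA => ->.
  by [].
- have e : den r \oc p \oc al \oc (k \oc t2 \oc t3)
         = den r \oc (ep \oc t1) \oc t2 \oc t3 by rewrite d1 !acompA.
  have wr := den_weak r.
  by rewrite e; do !apply: weak_comp => //.
Qed.

Definition roof_class X Y (r : roof X Y) : roof X Y -> Prop :=
  fun r' => roof_eqv r r'.

Lemma roof_classP X Y (r r' : roof X Y) :
  roof_class r = roof_class r' <-> roof_eqv r r'.
Proof.
split=> [e|e]; first by change (roof_class r r'); rewrite e; exact: roof_eqv_refl.
apply: funext => u; apply: propext; split; last exact: roof_eqv_trans.
exact/roof_eqv_trans/roof_eqv_sym.
Qed.

Definition frac_hom (X Y : A) : Type :=
  {E : roof X Y -> Prop | exists r, E = roof_class r}.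

Definition frac X Y (r : roof X Y) : frac_hom X Y :=
  exist _ (roof_class r) (ex_intro _ r erefl).

Definition frac_repr X Y (E : frac_hom X Y) : roof X Y := projT1 (cid (proj2_sig E)).

Lemma frac_eqP X Y (r r' : roof X Y) : frac r = frac r' <-> roof_eqv r r'.
Proof.
split=> [[/roof_classP//]|/roof_classP e].
by apply: eq_exist.
Qed.

Lemma frac_reprK X Y (E : frac_hom X Y) : frac (frac_repr E) = E.
Proof.
have : roof_class (frac_repr E) = sval E by rewrite /frac_repr; case: cid.
by case: E => E h /= e; apply: eq_exist.
Qed.

Lemma frac_reprE X Y (r : roof X Y) : roof_eqv (frac_repr (frac r)) r.
Proof. by apply/frac_eqP; rewrite frac_reprK. Qed.

Definition frac_comp X Y Z (F : frac_hom Y Z) (E : frac_hom X Y) : frac_hom X Z :=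
  frac (roof_comp (frac_repr F) (frac_repr E)).

Lemma frac_compE X Y Z (q : roof Y Z) (r : roof X Y) :
  frac_comp (frac q) (frac r) = frac (roof_comp q r).
Proof.
apply/frac_eqP; apply: (@roof_eqv_trans _ _ _ (roof_comp q (frac_repr (frac r)))).
  exact/roof_comp_eqvr/frac_reprE.
exact/roof_comp_eqvl/frac_reprE.
Qed.

Lemma frac_comp1m X Y (E : frac_hom X Y) : frac_comp (frac (roof_id Y)) E = E.
Proof. by rewrite -[E]frac_reprK frac_compE; apply/frac_eqP/roof_comp1m. Qed.

Lemma frac_compm1 X Y (E : frac_hom X Y) : frac_comp E (frac (roof_id X)) = E.
Proof. by rewrite -[E]frac_reprK frac_compE; apply/frac_eqP/roof_compm1. Qed.

Lemma frac_compA X Y Z V (G : frac_hom Z V) (F : frac_hom Y Z) (E : frac_hom X Y) :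
  frac_comp G (frac_comp F E) = frac_comp (frac_comp G F) E.
Proof.
rewrite -[E]frac_reprK -[F]frac_reprK -[G]frac_reprK !frac_compE.
exact/frac_eqP/roof_compA.
Qed.

Definition fractions : category :=
  @Category (cob A) frac_hom (fun X => frac (roof_id X)) frac_comp
    frac_comp1m frac_compm1 frac_compA.

Definition loc_map (X Y : A) (f : arr X Y) : frac_hom X Y :=
  frac (Roof f (weak_id W X)).

Lemma loc_mapM (X Y Z : A) (g : arr Y Z) (f : arr X Y) :
  loc_map (g \oc f) = frac_comp (loc_map g) (loc_map f).
Proof.
rewrite frac_compE; apply/frac_eqP; rewrite /roof_comp.
case: (weak_square _ _) => U p p' w /= c; rewrite /= in c *.
exists U, p, (ida U); rewrite /= !acompm1 !acomp1m; split=> //.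
by rewrite -acompA c acomp1m.
Qed.

Definition localization : functor A fractions :=
  @Functor A fractions (fun X => X) loc_map (fun X => erefl) loc_mapM.

End Fractions.

(* The finiteness of hom-sets required of a combinatorial category is built
   in here, and hence is not repeated in typeII. *)
Record fincat := FinCat {
  ob :> Type;
  hom : ob -> ob -> finType;
  idm : forall x, hom x x;
  hcomp : forall x y z, hom y z -> hom x y -> hom x z;
  hcomp1m : forall x y (f : hom x y), hcomp (idm y) f = f;
  hcompm1 : forall x y (f : hom x y), hcomp f (idm x) = f;
  hcompA : forall x y z w (h : hom z w) (g : hom y z) (f : hom x y),
    hcomp h (hcomp g f) = hcomp (hcomp h g) f
}.
Arguments hom {_} x y.
Arguments idm {_} x.
Arguments hcomp {_ x y z} _ _.

Notation "g \om f" := (hcomp g f) (at level 40, left associativity).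

Definition op (D : fincat) : fincat :=
  @FinCat (ob D) (fun x y => @hom D y x) (fun x => idm x)
    (fun x y z g f => f \om g)
    (fun x y f => hcompm1 f) (fun x y f => hcomp1m f)
    (fun x y z w h g f => esym (hcompA f g h)).

Definition isomorphism (D : fincat) (x y : D) (f : hom x y) : Prop :=
  exists g : hom y x, g \om f = idm x /\ f \om g = idm y.

Definition monomorphism (D : fincat) (y z : D) (g : hom y z) : Prop :=
  forall (x : D) (f f' : hom x y), g \om f = g \om f' -> f = f'.

Definition skeletal (D : fincat) : Prop :=
  forall x y : D, (exists f : hom x y, isomorphism f) -> x = y.

Record typeII (D : fincat) : Prop := TypeII {
  typeII_skeletal : skeletal D;
  typeII_EI : forall (x : D) (f : hom x x), isomorphism f;
  typeII_mono : forall (x y : D) (f : hom x y), monomorphism f;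
  typeII_finite : forall x : D, finite_set [set y : D | inhabited (hom y x)]
}.

Definition left_ore (D : fincat) : Prop :=
  forall (x y y' : D) (f : hom x y) (f' : hom x y'),
    exists (z : D) (g : hom y z) (g' : hom y' z), g \om f = g' \om f'.

Section LmodConstructions.
Variable R : fieldType.

Definition dual (U : lmodType R) : Type := {linear U -> R^o}.

Section Dual.
Variable U : lmodType R.
Implicit Types f g h : dual U.

Lemma dualP f g : (f : U -> R^o) =1 g -> f = g.
Proof.
case: f g => [f [[a] [b]]] [g [[c] [d]]] /= /funext e; subst g.
by rewrite (Prop_irrelevance a c) (Prop_irrelevance b d).
Qed.

HB.instance Definition _ := gen_eqMixin (dual U).
HB.instance Definition _ := gen_choiceMixin (dual U).

Definition dual0 : dual U := (\0 : {linear U -> R^o}).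
Definition dualN f : dual U := (\- f : {linear U -> R^o}).
Definition dualD f g : dual U := (f \+ g : {linear U -> R^o}).
Definition dualZ (a : R) f : dual U := (a \*: f : {linear U -> R^o}).

Lemma dualDA : associative dualD.
Proof. by move=> f g h; apply: dualP => u /=; rewrite addrA. Qed.
Lemma dualDC : commutative dualD.
Proof. by move=> f g; apply: dualP => u /=; rewrite addrC. Qed.
Lemma dual0D : left_id dual0 dualD.
Proof. by move=> f; apply: dualP => u /=; rewrite add0r. Qed.
Lemma dualND : left_inverse dual0 dualN dualD.
Proof. by move=> f; apply: dualP => u /=; rewrite addNr. Qed.

HB.instance Definition _ := GRing.isZmodule.Build (dual U) dualDA dualDC dual0D dualND.

Lemma dualZA a b f : dualZ a (dualZ b f) = dualZ (a * b) f.
Proof. by apply: dualP => u /=; rewrite scalerA. Qed.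
Lemma dual1Z : left_id 1 dualZ.
Proof. by move=> f; apply: dualP => u /=; rewrite scale1r. Qed.
Lemma dualZDr : right_distributive dualZ +%R.
Proof. by move=> a f g; apply: dualP => u /=; rewrite scalerDr. Qed.
Lemma dualZDl f : {morph dualZ^~ f : a b / a + b}.
Proof. by move=> a b; apply: dualP => u /=; rewrite scalerDl. Qed.

HB.instance Definition _ :=
  GRing.Zmodule_isLmodule.Build R (dual U) dualZA dual1Z dualZDr dualZDl.

End Dual.

Definition dual_map (U V : lmodType R) (u : {linear U -> V}) (l : dual V) :
  dual U := ((l : {linear V -> R^o}) \o u : {linear U -> R^o}).

Lemma dual_map_linear (U V : lmodType R) (u : {linear U -> V}) :
  linear (dual_map u).
Proof. by move=> a f g; apply: dualP. Qed.

Section Product.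
Variables (I : Type) (V : I -> lmodType R).

Definition dprod : Type := forall i, V i.
Implicit Types u v w : dprod.

HB.instance Definition _ := gen_eqMixin dprod.
HB.instance Definition _ := gen_choiceMixin dprod.

Definition dprod0 : dprod := fun=> 0.
Definition dprodN u : dprod := fun i => - u i.
Definition dprodD u v : dprod := fun i => u i + v i.
Definition dprodZ (a : R) u : dprod := fun i => a *: u i.

Lemma dprodDA : associative dprodD.
Proof. by move=> u v w; apply: functional_extensionality_dep => i; exact: addrA. Qed.
Lemma dprodDC : commutative dprodD.
Proof. by move=> u v; apply: functional_extensionality_dep => i; exact: addrC. Qed.
Lemma dprod0D : left_id dprod0 dprodD.
Proof. by move=> u; apply: functional_extensionality_dep => i; exact: add0r. Qed.
Lemma dprodND : left_inverse dprod0 dprodN dprodD.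
Proof. by move=> u; apply: functional_extensionality_dep => i; exact: addNr. Qed.

HB.instance Definition _ :=
  GRing.isZmodule.Build dprod dprodDA dprodDC dprod0D dprodND.

Lemma dprodZA a b u : dprodZ a (dprodZ b u) = dprodZ (a * b) u.
Proof. by apply: functional_extensionality_dep => i; exact: scalerA. Qed.
Lemma dprod1Z : left_id 1 dprodZ.
Proof. by move=> u; apply: functional_extensionality_dep => i; exact: scale1r. Qed.
Lemma dprodZDr : right_distributive dprodZ +%R.
Proof. by move=> a u v; apply: functional_extensionality_dep => i; exact: scalerDr. Qed.
Lemma dprodZDl u : {morph dprodZ^~ u : a b / a + b}.
Proof. by move=> a b; apply: functional_extensionality_dep => i; exact: scalerDl. Qed.

HB.instance Definition _ :=
  GRing.Zmodule_isLmodule.Build R dprod dprodZA dprod1Z dprodZDr dprodZDl.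

End Product.

Record subspace (U : lmodType R) := Subspace {
  ss_set : set U;
  ss0 : ss_set 0;
  ssL : forall a u v, ss_set u -> ss_set v -> ss_set (a *: u + v)
}.

Section Subspace.
Variables (U : lmodType R) (S : subspace U).

Definition subsp : Type := {u : U | u \in ss_set S}.

HB.instance Definition _ := SubType.copy subsp {u : U | u \in ss_set S}.
HB.instance Definition _ := [Choice of subsp by <:].

Lemma subsp_closed : subsemimod_closed (fun u : U => u \in ss_set S).
Proof.
have S0 : (0 : U) \in ss_set S by rewrite inE; exact: ss0.
split; last first.
  move=> a u; rewrite !unfold_in => /asboolP Su; apply/asboolP.
  by rewrite -[_ *: _]addr0; apply: ssL => //; exact: ss0.
split=> // u v; rewrite !unfold_in => /asboolP Su /asboolP Sv; apply/asboolP.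
by rewrite -[u]scale1r; apply: ssL.
Qed.

HB.instance Definition _ :=
  GRing.SubChoice_isSubLmodule.Build R U (fun u => u \in ss_set S) subsp subsp_closed.

End Subspace.

Section Linearization.

(* {ffun S -> R} is the vector space with basis S; pushforward u sends the *)
(* basis vector of s to that of u s. *)
Definition pushforward (S T : finType) (u : S -> T) (p : {ffun S -> R^o}) :
  {ffun T -> R^o} := [ffun t => \sum_(s | u s == t) p s].

Lemma pushforward_linear (S T : finType) (u : S -> T) : linear (pushforward u).
Proof.
move=> a p q; apply/ffunP => t; rewrite !ffunE scaler_sumr -big_split /=.
by apply: eq_bigr => s _; rewrite !ffunE.
Qed.

Lemma pushforward_id (S : finType) (u : S -> S) (p : {ffun S -> R^o}) :
  u =1 id -> pushforward u p = p.
Proof.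
move=> uE; apply/ffunP => t; rewrite ffunE (eq_bigl (pred1 t)) ?big_pred1_eq //.
by move=> s /=; rewrite uE.
Qed.

Lemma pushforward_comp (S T T' : finType) (u : S -> T) (v : T -> T') (w : S -> T')
    (p : {ffun S -> R^o}) :
  (forall s, w s = v (u s)) -> pushforward w p = pushforward v (pushforward u p).
Proof.
move=> wE; apply/ffunP => t; rewrite !ffunE.
rewrite (partition_big u (fun t' => v t' == t)) => [|s]; last by rewrite wE.
apply: eq_bigr => t' vt; rewrite ffunE; apply: eq_bigl => s.
by rewrite wE; case: (u s =P t') => [->|_]; rewrite ?vt ?andbF.
Qed.

End Linearization.

End LmodConstructions.

Record dmod (R : fieldType) (D : fincat) := DMod {
  mob :> D -> lmodType R;
  act : forall x y : D, hom x y -> mob x -> mob y;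
  act_linear : forall (x y : D) (f : hom x y), linear (act f);
  act1 : forall (x : D) v, act (idm x) v = v;
  actM : forall (x y z : D) (g : hom y z) (f : hom x y) v,
    act (g \om f) v = act g (act f v)
}.
Arguments act {R D} d {x y} f v.
Arguments act_linear {R D} d {x y} f.

HB.instance Definition _ R D (V : dmod R D) (x y : D) (f : hom x y) :=
  GRing.isLinear.Build R (V x) (V y) *:%R (act V f) (act_linear V f).

Record mhom (R : fieldType) (D : fincat) (V W : dmod R D) := MHom {
  mfun :> forall x : D, V x -> W x;
  mfun_linear : forall x, linear (@mfun x);
  mfun_act : forall (x y : D) (f : hom x y) v,
    mfun (act V f v) = act W f (mfun v)
}.
Arguments mfun {R D V W} m x v.
Arguments mfun_linear {R D V W} m x.

HB.instance Definition _ R D (V W : dmod R D) (u : mhom V W) (x : D) :=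
  GRing.isLinear.Build R (V x) (W x) *:%R (mfun u x) (mfun_linear u x).

Section DMod.
Variables (R : fieldType) (D : fincat).
Implicit Types V W : dmod R D.

Lemma mhomP V W (u v : mhom V W) : (forall x w, u x w = v x w) -> u = v.
Proof.
case: u v => [u ul ua] [v vl va] /= e.
have {}e : u = v.
  by apply: functional_extensionality_dep => x; apply: funext => w; exact: e.
by subst v; congr MHom; exact: Prop_irrelevance.
Qed.

Definition mid V : mhom V V :=
  @MHom R D V V (fun x v => v) (fun x a u v => erefl) (fun x y f v => erefl).

Lemma mcomp_linear V W X (u : mhom W X) (v : mhom V W) x :
  linear (fun w => u x (v x w)).
Proof. by move=> a w w'; rewrite !linearP. Qed.

Lemma mcomp_act V W X (u : mhom W X) (v : mhom V W) (x y : D) (f : hom x y) w :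
  u y (v y (act V f w)) = act X f (u x (v x w)).
Proof. by rewrite !mfun_act. Qed.

Definition mcomp V W X (u : mhom W X) (v : mhom V W) : mhom V X :=
  MHom (mcomp_linear u v) (mcomp_act u v).

Definition Dmod : category.
Proof.
by refine (@Category (dmod R D) (@mhom R D) mid mcomp _ _ _) => *; apply: mhomP.
Defined.

Section HomSpace.
Variables V W : dmod R D.
Implicit Types u v w : mhom V W.

HB.instance Definition _ := gen_eqMixin (mhom V W).
HB.instance Definition _ := gen_choiceMixin (mhom V W).

Definition mhom0 : mhom V W.
Proof.
refine (@MHom R D V W (fun _ _ => 0) _ _) => [x a u v|x y f v].
  by rewrite scaler0 addr0.
by rewrite linear0.
Defined.

Definition mhomN u : mhom V W.
Proof.
refine (@MHom R D V W (fun x z => - u x z) _ _) => [x a w w'|x y f v].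
  by rewrite linearP opprD scalerN.
by rewrite mfun_act linearN.
Defined.

Definition mhomD u v : mhom V W.
Proof.
refine (@MHom R D V W (fun x z => u x z + v x z) _ _) => [x a w w'|x y f w].
  by rewrite !linearP scalerDr addrACA.
by rewrite !mfun_act linearD.
Defined.

Definition mhomZ (a : R) u : mhom V W.
Proof.
refine (@MHom R D V W (fun x z => a *: u x z) _ _) => [x b w w'|x y f w].
  by rewrite linearP scalerDr !scalerA mulrC.
by rewrite !mfun_act linearZ.
Defined.

Lemma mhomDA : associative mhomD.
Proof. by move=> u v w; apply: mhomP => x z /=; rewrite addrA. Qed.
Lemma mhomDC : commutative mhomD.
Proof. by move=> u v; apply: mhomP => x z /=; rewrite addrC. Qed.
Lemma mhom0D : left_id mhom0 mhomD.
Proof. by move=> u; apply: mhomP => x z /=; rewrite add0r. Qed.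
Lemma mhomND : left_inverse mhom0 mhomN mhomD.
Proof. by move=> u; apply: mhomP => x z /=; rewrite addNr. Qed.

HB.instance Definition _ :=
  GRing.isZmodule.Build (mhom V W) mhomDA mhomDC mhom0D mhomND.

Lemma mhomZA a b u : mhomZ a (mhomZ b u) = mhomZ (a * b) u.
Proof. by apply: mhomP => x z /=; rewrite scalerA. Qed.
Lemma mhom1Z : left_id 1 mhomZ.
Proof. by move=> u; apply: mhomP => x z /=; rewrite scale1r. Qed.
Lemma mhomZDr : right_distributive mhomZ +%R.
Proof. by move=> a u v; apply: mhomP => x z /=; rewrite scalerDr. Qed.
Lemma mhomZDl u : {morph mhomZ^~ u : a b / a + b}.
Proof. by move=> a b; apply: mhomP => x z /=; rewrite scalerDl. Qed.

HB.instance Definition _ :=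
  GRing.Zmodule_isLmodule.Build R (mhom V W) mhomZA mhom1Z mhomZDr mhomZDl.

End HomSpace.

Definition msurjective V W (u : mhom V W) : Prop :=
  forall x (w : W x), exists v, u x v = w.

Definition minjective V W (u : mhom V W) : Prop := forall x, injective (u x).

Definition projective (P : dmod R D) : Prop :=
  forall V W (u : mhom V W) (p : mhom P W), msurjective u ->
    exists q : mhom P V, mcomp u q = p.

Definition injective_mod (Q : dmod R D) : Prop :=
  forall V W (u : mhom V W) (p : mhom V Q), minjective u ->
    exists q : mhom W Q, mcomp q u = p.

Definition torsion V : Prop :=
  forall (x : D) (v : V x), exists (y : D) (f : hom x y), act V f v = 0.

Definition finite_diml (U : lmodType R) : Prop :=
  exists (n : nat) (e : 'I_n -> U),
    forall u, exists c : 'I_n -> R, u = \sum_(i < n) c i *: e i.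

(* That is, the sum over x of the dimensions of the V x is finite. *)
Definition finite_dimensional V : Prop :=
  finite_set [set x : D | exists v : V x, v != 0] /\
  forall x : D, finite_diml (V x).

Section DirectSum.
Variables (I : finType) (X : I -> dmod R D).

Definition dsum_act (x y : D) (f : hom x y) (v : dprod (fun i => X i x)) :
  dprod (fun i => X i y) := fun i => act (X i) f (v i).

Definition dsum : dmod R D.
Proof.
refine (@DMod R D (fun x => dprod (fun i => X i x)) dsum_act _ _ _).
- by move=> x y f a u v; apply: functional_extensionality_dep => i; exact: linearP.
- by move=> x v; apply: functional_extensionality_dep => i; exact: act1.
- by move=> x y z g f v; apply: functional_extensionality_dep => i; exact: actM.
Defined.

End DirectSum.

Record submod V := Submod {
  sm_set :> forall x : D, subspace (V x);
  sm_act : forall (x y : D) (f : hom x y) v, ss_set (sm_set x) v -> ss_set (sm_set y) (act V f v)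
}.

Section Submodule.
Variables (V : dmod R D) (S : submod V).

Lemma submod_act_subproof (x y : D) (f : hom x y) (v : subsp (S x)) :
  act V f (val v) \in ss_set (S y).
Proof. by rewrite inE; apply: sm_act; have := valP v; rewrite inE. Qed.

Definition submod_act (x y : D) (f : hom x y) (v : subsp (S x)) : subsp (S y) :=
  Sub (act V f (val v)) (submod_act_subproof f v).

Definition submodule : dmod R D.
Proof.
refine (@DMod R D (fun x => subsp (S x)) submod_act _ _ _).
- by move=> x y f a u v; apply: val_inj; rewrite /= linearP.
- by move=> x v; apply: val_inj => /=; exact: act1.
- by move=> x y z g f v; apply: val_inj => /=; exact: actM.
Defined.

Definition submod_incl : mhom submodule V.
Proof. by refine (@MHom R D submodule V (fun x v => val v) _ _). Defined.

End Submodule.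

End DMod.

Arguments mid {R D} V.

Section Representable.
Variables (R : fieldType) (D : fincat).

Definition repr_act (x y z : D) (g : hom y z) (p : {ffun hom x y -> R^o}) :
  {ffun hom x z -> R^o} := pushforward (hcomp g) p.

Definition repr_mod (x : D) : dmod R D.
Proof.
refine (@DMod R D (fun y => {ffun hom x y -> R^o}) (@repr_act x) _ _ _).
- by move=> y z g; exact: pushforward_linear.
- by move=> y p; apply: pushforward_id => f; exact: hcomp1m.
- by move=> y z w g f p; apply: pushforward_comp => k; rewrite -hcompA.
Defined.

Definition precomp (x y : D) (f : hom x y) : mhom (repr_mod y) (repr_mod x).
Proof.
refine (@MHom R D (repr_mod y) (repr_mod x)
  (fun z => pushforward (fun g : hom y z => g \om f)) _ _).
- by move=> z; exact: pushforward_linear.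
- move=> z w g p /=; rewrite /repr_act.
  transitivity (pushforward (fun k : hom y z => g \om (k \om f)) p).
    by apply: esym; apply: pushforward_comp => k; rewrite hcompA.
  exact: pushforward_comp.
Defined.

Definition finitely_generated (V : dmod R D) : Prop :=
  exists (I : finType) (x : I -> D) (u : mhom (dsum (fun i => repr_mod (x i))) V),
    msurjective u.

Definition noetherian (V : dmod R D) : Prop :=
  forall S : submod V, finitely_generated (submodule S).

Definition LN : Prop :=
  forall V : dmod R D, finitely_generated V -> noetherian V.

Definition LS : Prop :=
  forall V : dmod R D, projective V -> injective_mod V.

Definition NV : Prop :=
  forall V : dmod R D, finitely_generated V -> ~ torsion V ->
    exists (x : D) (u : mhom V (repr_mod x)), u <> 0.

Definition fgmod : category := fullsub (A := Dmod R D) finitely_generated.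

Definition fdmod : category := fullsub (A := Dmod R D) (@finite_dimensional R D).

End Representable.

Section SerreQuotient.
Variables (R : fieldType) (D : fincat).

(* The kernel of s is torsion and the cokernel of s is torsion; the class of *)
(* act W f w in the cokernel vanishes iff act W f w is in the image of s. *)
Definition torsion_iso (V W : dmod R D) (s : mhom V W) : Prop :=
  (forall (x : D) (v : V x), s x v = 0 ->
     exists (y : D) (f : hom x y), act V f v = 0) /\
  (forall (x : D) (w : W x),
     exists (y : D) (f : hom x y) (v : V y), act W f w = s y v).

Lemma torsion_iso_id (V : dmod R D) : torsion_iso (mid V).
Proof.
split=> x v; first by move=> /= ->; exists x, (idm x); rewrite linear0.
by exists x, (idm x), v; rewrite act1.
Qed.

Lemma torsion_iso_comp (V W X : dmod R D) (t : mhom W X) (s : mhom V W) :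
  torsion_iso t -> torsion_iso s -> torsion_iso (mcomp t s).
Proof.
move=> [kt ct] [ks cs]; split=> x v /=.
  move=> /kt [y [f]]; rewrite -mfun_act => /ks [z [g e]].
  by exists z, (g \om f); rewrite actM.
have [y [f [w e]]] := ct x v; have [z [g [u e']]] := cs y w.
by exists z, (g \om f), u; rewrite actM e -e' mfun_act.
Qed.

Section Pullback.
Variables (V W X : dmod R D) (f : mhom V W) (s : mhom X W).

Definition dpair : dmod R D.
Proof.
refine (@DMod R D (fun x => (V x * X x)%type)
  (fun x y g v => (act V g v.1, act X g v.2)) _ _ _).
- by move=> x y g a [u u'] [v v']; rewrite /= !linearP.
- by move=> x [v v']; rewrite /= !act1.
- by move=> x y z g h [v v']; rewrite /= !actM.
Defined.

Definition pullback_subspace (x : D) : subspace (dpair x).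
Proof.
refine (@Subspace R (dpair x) [set v | f x v.1 = s x v.2] _ _).
- by rewrite /= !linear0.
- by move=> a u v /= eu ev; rewrite !linearP /= eu ev.
Defined.

Definition pullback : submod dpair.
Proof.
refine (@Submod R D dpair pullback_subspace _) => x y g v /= e.
by rewrite !mfun_act e.
Defined.

Definition dpair_fst : mhom dpair V.
Proof. by refine (@MHom R D dpair V (fun x v => v.1) _ _). Defined.

Definition dpair_snd : mhom dpair X.
Proof. by refine (@MHom R D dpair X (fun x v => v.2) _ _). Defined.

Definition pullback_fst : mhom (submodule pullback) V :=
  mcomp dpair_fst (submod_incl pullback).

Definition pullback_snd : mhom (submodule pullback) X :=
  mcomp dpair_snd (submod_incl pullback).

Lemma pullback_comm : mcomp f pullback_fst = mcomp s pullback_snd.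
Proof. by apply: mhomP => x v /=; have := valP v; rewrite inE. Qed.

Lemma pullback_fst_torsion_iso : torsion_iso s -> torsion_iso pullback_fst.
Proof.
move=> [ks cs]; split=> x v /=.
  case: v => -[v w] vw /= v0; subst v.
  have := vw; rewrite inE /= linear0 => /esym /ks [y [g e]].
  by exists y, g; apply: val_inj; rewrite /= e linear0.
have [y [g [w e]]] := cs x (f x v).
have h : ((act V g v, w) : dpair y) \in ss_set (pullback y).
  by rewrite inE /= mfun_act.
by exists y, g, (Sub ((act V g v, w) : dpair y) h).
Qed.

Lemma dpair_fg :
  finitely_generated V -> finitely_generated X -> finitely_generated dpair.
Proof.
move=> [I [xI [u su]]] [J [xJ [v sv]]].
pose xx (k : I + J) := match k with inl i => xI i | inr j => xJ j end.
exists (I + J)%type, xx.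
pose w (x : D) (p : dsum (fun k => repr_mod R (xx k)) x) : dpair x :=
  (u x (fun i => p (inl i)), v x (fun j => p (inr j))).
have wl x : linear (@w x).
  move=> a p q; congr pair.
    exact: (mfun_linear u x a (fun i => p (inl i)) (fun i => q (inl i))).
  exact: (mfun_linear v x a (fun j => p (inr j)) (fun j => q (inr j))).
have wa x y (g : hom x y) p : w y (act _ g p) = act dpair g (w x p).
  congr pair; first exact: (mfun_act u g (fun i => p (inl i))).
  exact: (mfun_act v g (fun j => p (inr j))).
exists (MHom wl wa) => x [a b] /=.
have [p <-] := su x a; have [q <-] := sv x b.
by exists (fun k => match k return repr_mod R (xx k) x with inl i => p i | inr j => q j end).
Qed.

End Pullback.

Definition equalizer_subspace (V W : dmod R D) (f g : mhom V W) (x : D) :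
  subspace (V x).
Proof.
refine (@Subspace R (V x) [set v | f x v = g x v] _ _).
- by rewrite /= !linear0.
- by move=> a u v /= eu ev; rewrite !linearP /= eu ev.
Defined.

Definition equalizer (V W : dmod R D) (f g : mhom V W) : submod V.
Proof.
refine (@Submod R D V (equalizer_subspace f g) _) => x y h v /= e.
by rewrite !mfun_act e.
Defined.

Lemma equalizer_torsion_iso (V W X : dmod R D) (f g : mhom V W) (s : mhom W X) :
  torsion_iso s -> mcomp s f = mcomp s g ->
  torsion_iso (submod_incl (equalizer f g)).
Proof.
move=> [ks cs] e; split=> x v /=.
  move=> v0; exists x, (idm x); apply: val_inj => /=.
  by rewrite v0 linear0.
have /ks [y [h eh]] : s x (f x v - g x v) = 0.
  rewrite linearB; apply/eqP; rewrite subr_eq0; apply/eqP.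
  exact: (congr1 (fun m : mhom V X => m x v) e).
have hin : act V h v \in ss_set (equalizer f g y).
  rewrite inE /= !mfun_act; apply/eqP; rewrite -subr_eq0; apply/eqP.
  by rewrite -eh linearB.
by exists y, h, (Sub (act V h v) hin).
Qed.

Hypothesis hLN : LN R D.

Definition fg_submodule (V : fgmod R D) (S : submod (sval V)) : fgmod R D :=
  exist _ (submodule S) (hLN (proj2_sig V) S).

Definition torsion_calculus : calculus (fgmod R D).
Proof.
refine (@Calculus (fgmod R D)
  (fun V W s => torsion_iso (s : mhom (sval V) (sval W))) _ _ _ _).
- by move=> V; exact: torsion_iso_id.
- by move=> V W X t s; exact: torsion_iso_comp.
- move=> V W X f s hs.
  pose VX : fgmod R D := exist _ (dpair (sval V) (sval X))
    (dpair_fg (proj2_sig V) (proj2_sig X)).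
  apply: (@Square (fgmod R D) _ V W X f s (fg_submodule (V := VX) (pullback f s))
    (pullback_fst f s) (pullback_snd f s)).
    exact: pullback_fst_torsion_iso.
  exact: pullback_comm.
- move=> V W X f g s hs e.
  exists (fg_submodule (equalizer f g)), (submod_incl (equalizer f g)); split.
    exact: equalizer_torsion_iso hs e.
  by apply: mhomP => x v /=; have := valP v; rewrite inE.
Defined.

(* The quotient of the abelian category D-mod by the Serre subcategory of *)
(* torsion modules is its localization at the morphisms whose kernel and *)
(* cokernel are torsion. *)
Definition serre_quotient : category := fractions torsion_calculus.

Definition quotient_functor : functor (fgmod R D) serre_quotient :=
  localization torsion_calculus.

End SerreQuotient.

Record sieve (C : fincat) (x : C) := Sieve {
  sv :> forall y : C, hom y x -> Prop;
  sv_comp : forall (y z : C) (f : hom y x) (g : hom z y), sv f -> sv (f \om g)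
}.

Definition sieve_max (C : fincat) (x : C) : sieve x :=
  @Sieve C x (fun _ _ => True) (fun _ _ _ _ _ => I).

Lemma sieve_pull_subproof (C : fincat) (x y : C) (h : hom y x) (S : sieve x)
  (z w : C) (f : hom z y) (g : hom w z) :
  S z (h \om f) -> S w (h \om (f \om g)).
Proof. by move=> Sf; rewrite hcompA; exact: sv_comp. Qed.

Definition sieve_pull (C : fincat) (x y : C) (h : hom y x) (S : sieve x) :
  sieve y := @Sieve C y (fun z f => S z (h \om f)) (@sieve_pull_subproof C x y h S).

Record topology (C : fincat) := Topology {
  covers :> forall x : C, sieve x -> Prop;
  covers_max : forall x : C, covers (sieve_max x);
  covers_pull : forall (x y : C) (h : hom y x) (S : sieve x),
    covers S -> covers (sieve_pull h S);
  covers_trans : forall (x : C) (S T : sieve x), covers S ->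
    (forall (y : C) (f : hom y x), S y f -> covers (sieve_pull f T)) -> covers T
}.

Definition sieve_nonempty (C : fincat) (x : C) (S : sieve x) : Prop :=
  exists (y : C) (f : hom y x), S y f.

Definition atomic_topology (C : fincat) (ore : left_ore (op C)) : topology C.
Proof.
refine (@Topology C (@sieve_nonempty C) _ _ _).
- by move=> x; exists x, (idm x).
- move=> x y h S [z [f Sf]].
  have [w [g [g' e]]] := ore x y z h f.
  by exists w, g; rewrite /= [h \om g]e; exact: sv_comp.
- move=> x S T [y [f Sf]] /(_ y f Sf) [z [g Tg]].
  by exists z, (f \om g).
Defined.

Record presheaf (C : fincat) := Presheaf {
  sect :> C -> Type;
  restr : forall x y : C, hom y x -> sect x -> sect y;
  restr1 : forall (x : C) a, restr (idm x) a = a;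
  restrM : forall (x y z : C) (f : hom y x) (g : hom z y) a,
    restr (f \om g) a = restr g (restr f a)
}.
Arguments restr {C} p {x y} f a.

Definition matching_family (C : fincat) (F : presheaf C) (x : C) (S : sieve x)
  (s : forall (y : C) (f : hom y x), S y f -> F y) : Prop :=
  forall (y z : C) (f : hom y x) (g : hom z y) (Sf : S y f) (Sfg : S z (f \om g)),
    s z (f \om g) Sfg = restr F g (s y f Sf).

Definition sheaf (C : fincat) (J : topology C) (F : presheaf C) : Prop :=
  forall (x : C) (S : sieve x), J x S ->
  forall s : (forall (y : C) (f : hom y x), S y f -> F y), matching_family s ->
    exists! a : F x, forall (y : C) (f : hom y x) (Sf : S y f),
      restr F f a = s y f Sf.

Section Sheaves.
Variables (R : fieldType) (C : fincat).

Definition underlying_presheaf (V : dmod R (op C)) : presheaf C :=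
  @Presheaf C (fun x => V x) (fun x y f v => @act R (op C) V x y f v)
    (fun x v => @act1 R (op C) V x v)
    (fun x y z f g v => @actM R (op C) V x y z g f v).

Definition sh (J : topology C) : category :=
  fullsub (A := fgmod R (op C))
    (fun V => sheaf J (underlying_presheaf (sval V))).

Definition sh_incl (J : topology C) : functor (sh J) (fgmod R (op C)) :=
  incl _.

End Sheaves.

Section Nakayama.
Variables (R : fieldType) (D : fincat).

Lemma mcomp_linearl (V W X : dmod R D) (u : mhom W X) :
  linear (fun p : mhom V W => mcomp u p).
Proof. by move=> a p q; apply: mhomP => x v /=; rewrite linearP. Qed.

Lemma mcomp_linearr (V W X : dmod R D) (u : mhom V W) :
  linear (fun p : mhom W X => mcomp p u).
Proof. by move=> a p q; apply: mhomP. Qed.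

HB.instance Definition _ (V W X : dmod R D) (u : mhom W X) :=
  GRing.isLinear.Build R (mhom V W) (mhom V X) *:%R (mcomp u) (mcomp_linearl u).

Definition mcompr (V W X : dmod R D) (u : mhom V W) (p : mhom W X) : mhom V X :=
  mcomp p u.

HB.instance Definition _ (V W X : dmod R D) (u : mhom V W) :=
  GRing.isLinear.Build R (mhom W X) (mhom V X) *:%R (mcompr u) (mcomp_linearr u).

(* A morphism f : x -> y induces Hom(V, P(y)) -> Hom(V, P(x)), hence a map *)
(* D Hom(V, P(x)) -> D Hom(V, P(y)). *)
Definition nakayama_act (V : dmod R D) (x y : D) (f : hom x y) :
  dual (mhom V (repr_mod R x)) -> dual (mhom V (repr_mod R y)) :=
  dual_map (mcomp (precomp R f)).

Definition nakayama_mod (V : dmod R D) : dmod R D.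
Proof.
refine (@DMod R D (fun x => dual (mhom V (repr_mod R x))) (@nakayama_act V) _ _ _).
- by move=> x y f; exact: dual_map_linear.
- move=> x l; apply: dualP => p /=; congr (_ _); apply: mhomP => z v /=.
  by apply: pushforward_id => k; exact: hcompm1.
- move=> x y z g f l; apply: dualP => p /=; congr (_ _); apply: mhomP => w v /=.
  by apply: pushforward_comp => k; rewrite hcompA.
Defined.

Definition nakayama_hom (V W : dmod R D) (u : mhom V W) :
  mhom (nakayama_mod V) (nakayama_mod W).
Proof.
refine (@MHom R D (nakayama_mod V) (nakayama_mod W)
  (fun x => dual_map (mcompr u)) _ _).
- by move=> x; exact: dual_map_linear.
- by move=> x y f l; apply: dualP => p /=; congr (_ _); apply: mhomP.
Defined.

Definition nakayama : functor (fgmod R D) (Dmod R D).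
Proof.
refine (@Functor (fgmod R D) (Dmod R D) (fun V => nakayama_mod (sval V))
  (fun V W u => nakayama_hom u) _ _).
- move=> V; apply: mhomP => x l; apply: dualP => p /=; congr (_ _).
  exact: mhomP.
- move=> V W X u v; apply: mhomP => x l; apply: dualP => p /=; congr (_ _).
  exact: mhomP.
Defined.

End Nakayama.

(* Main.v *)
From HB Require Import structures.
From mathcomp Require Import all_boot all_algebra.
From mathcomp Require Import boolp classical_sets cardinality functions.
Require Import Defs.

(** Write D for the opposite of C and P(x) for the representable modules.

    The representables are projective, hence injective by (LS), and they are
    torsion free because the morphisms of D are monomorphisms.  Consequently
    an element v of a finitely generated V that is killed by all maps from V
    to representables is torsion ([annihilated_torsion]): such elements form a
    submodule K, finitely generated by (LN), and if K were not torsion, (NV)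
    would give a nonzero map from K to some P(x), which would extend to V by
    injectivity although maps defined on V vanish on K.  The space
    Hom(V, P(x)) is finite dimensional, and nonzero for finitely many x only,
    so finitely many maps detect as much as all of them
    ([fg_jointly_spanning]): V modulo torsion embeds in a finite direct sum Q
    of representables.

    Call j : W -> Q saturated when it is injective with torsion-free cokernel.
    A finitely generated module is a sheaf for the atomic topology exactly when
    it has a saturated embedding in such a Q ([sheaf_saturated],
    [saturated_sheaf]).  As Q is injective and torsion free, saturated
    submodules of Q see torsion isomorphisms as isomorphisms
    ([torsion_iso_lift], [torsion_iso_cancel]), so morphisms from any V to a
    sheaf do not change in the Serre quotient.  And every finitely generated V
    becomes isomorphic there to the saturation of its image in Q
    ([saturation_torsion_iso]).  This is the first equivalence.

    For the same reason Hom(-, P(x)) inverts torsion isomorphisms, hence so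
    does the Nakayama functor nu, which therefore factors through the quotient.
    It remains to see that nu is an equivalence from sheaves to finite
    dimensional modules.  A map nu V -> nu W amounts, by reflexivity of finite
    dimensional spaces, to maps Hom(W, P(x)) -> Hom(V, P(x)) compatible with
    all morphisms between sums of representables.  Feeding them the components
    of j : W -> Q yields V -> Q; it lands in W because W is the common kernel
    of the maps from Q to representables that vanish on it
    ([saturated_cogenerated]).  Thus nu is fully faithful ([nakayama_full],
    [nakayama_faithful]).  Conversely, a finite dimensional M is cogenerated by
    finitely many functionals on its values, which is the same as an embedding
    of M in nu Q; then M is nu of the submodule of Q killed by the
    annihilator of M in Hom(Q, P(-)) ([nakayama_ess_surj]). *)

Set Implicit Arguments.
Unset Strict Implicit.
Unset Printing Implicit Defensive.

Import GRing.Theory.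
Local Open Scope ring_scope.

(** * Finite dimensional vector spaces *)

Section LinearAlgebra.
Variable R : fieldType.
Implicit Types U W X : lmodType R.

Definition linear_of U W (f : U -> W) (fl : linear f) : {linear U -> W} :=
  HB.pack f (GRing.isLinear.Build R U W *:%R f fl).

Lemma ssD U (S : subspace U) u v : ss_set S u -> ss_set S v -> ss_set S (u + v).
Proof. by move=> Su Sv; rewrite -[u]scale1r; apply: ssL. Qed.

Lemma ssZ U (S : subspace U) a u : ss_set S u -> ss_set S (a *: u).
Proof. by move=> Su; rewrite -[_ *: _]addr0; apply: ssL => //; exact: ss0. Qed.

Lemma ssN U (S : subspace U) u : ss_set S u -> ss_set S (- u).
Proof. by move=> Su; rewrite -scaleN1r; apply: ssZ. Qed.

Lemma ssB U (S : subspace U) u v : ss_set S u -> ss_set S v -> ss_set S (u - v).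
Proof. by move=> Su Sv; apply: ssD => //; apply: ssN. Qed.

Lemma ss_sum U (S : subspace U) (I : finType) (F : I -> U) :
  (forall i, ss_set S (F i)) -> ss_set S (\sum_i F i).
Proof. by move=> h; elim/big_ind: _ => //; [exact: ss0|exact: ssD]. Qed.

(** Induction on the number n of vectors that span U together with S.  If the
    first vector lies in S, drop it.  Otherwise enlarge S by its line, and
    correct the projection obtained for the larger subspace by the coordinate
    along that vector, which is unique because the vector is not in S. *)
Lemma complement_span U (n : nat) (e : 'I_n -> U) (S : subspace U) :
  (forall u, exists s (c : 'I_n -> R), ss_set S s /\ u = s + \sum_i c i *: e i) ->
  exists p : {linear U -> U},
    (forall u, ss_set S u -> p u = 0) /\ (forall u, ss_set S (u - p u)).
Proof.
elim: n e S => [|n IHn] e S spanS.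
  exists (\0 : {linear U -> U}); split=> // u; have [s [c [Ss ->]]] := spanS u.
  by rewrite big_ord0 addr0 subr0.
have [Se|nSe] := pselect (ss_set S (e ord0)).
  apply: (IHn (fun i => e (lift ord0 i))) => u.
  have [s [c [Ss ->]]] := spanS u.
  exists (s + c ord0 *: e ord0), (fun i => c (lift ord0 i)).
  by rewrite big_ord_recl addrA; split=> //; apply: ssD => //; exact: ssZ.
have T0 : exists c : R, ss_set S (0 - c *: e ord0).
  by exists 0; rewrite scale0r subr0; exact: ss0.
have TL a u v : (exists c : R, ss_set S (u - c *: e ord0)) ->
    (exists c : R, ss_set S (v - c *: e ord0)) ->
    exists c : R, ss_set S (a *: u + v - c *: e ord0).
  move=> [c Sc] [d Sd]; exists (a * c + d).
  rewrite scalerDl opprD addrACA -scalerA -scalerBr.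
  exact: ssL.
have [|p [pT Tp]] := IHn (fun i => e (lift ord0 i)) (Subspace T0 TL).
  move=> u; have [s [c [Ss ->]]] := spanS u.
  exists (s + c ord0 *: e ord0), (fun i => c (lift ord0 i)).
  by rewrite big_ord_recl addrA; split=> //=; exists (c ord0); rewrite addrK.
have [c Sc] := choice Tp.
have c_uniq u a : ss_set S (u - p u - a *: e ord0) -> a = c u.
  move=> Sa; apply/eqP; rewrite -subr_eq0; apply/negPn/negP => ac.
  apply: nSe; rewrite -[e ord0]scale1r -(mulVf ac) -scalerA; apply: ssZ.
  have -> : (a - c u) *: e ord0
      = (u - p u - c u *: e ord0) - (u - p u - a *: e ord0).
    by rewrite opprB [RHS]addrC addrA subrK scalerBl.
  exact: ssB.
have ql : linear (fun u => p u + c u *: e ord0).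
  move=> a u v; rewrite linearP scalerDr addrACA scalerA -scalerDl.
  congr (_ + _ *: _); apply/esym/c_uniq.
  rewrite linearP opprD addrACA -scalerBr scalerDl opprD addrACA -scalerA -scalerBr.
  exact: ssL.
exists (linear_of ql); split=> u /=.
  move=> Su; rewrite pT /=; last by exists 0; rewrite scale0r subr0.
  rewrite -(c_uniq u 0) ?scale0r ?addr0 // subr0.
  rewrite pT ?subr0 //=; by exists 0; rewrite scale0r subr0.
by rewrite opprD addrA.
Qed.

Lemma complement U (S : subspace U) : finite_diml U ->
  exists p : {linear U -> U},
    (forall u, ss_set S u -> p u = 0) /\ (forall u, ss_set S (u - p u)).
Proof.
move=> [n [e spanU]]; apply: (@complement_span U n e S) => u.
by have [c ->] := spanU u; exists 0, c; split; [exact: ss0|rewrite add0r].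
Qed.

Lemma linear_factor U W X (u : {linear U -> W}) (f : {linear U -> X}) :
  (forall w, exists v, u v = w) -> (forall v, u v = 0 -> f v = 0) ->
  exists g : {linear W -> X}, forall v, g (u v) = f v.
Proof.
move=> /choice [r ur] ker; have fr v w : u v = u w -> f v = f w.
  move=> e; apply/eqP; rewrite -subr_eq0 -linearB; apply/eqP/ker.
  by rewrite linearB e subrr.
have gl : linear (fun w => f (r w)).
  by move=> a w w'; rewrite -linearP; apply: fr; rewrite linearP !ur.
by exists (linear_of gl) => v /=; apply: fr.
Qed.

Lemma rV_finite_diml n : finite_diml 'rV[R]_n.
Proof.
exists n, (fun i => delta_mx 0 i) => u; exists (fun i => u 0 i).
exact: row_sum_delta.
Qed.

(** A linear section of the surjection from row vectors defined by a spanning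
    family e provides the coordinate forms l i.  Reflexivity and separation
    follow from this expansion alone. *)
Lemma dual_basis U : finite_diml U ->
  exists (n : nat) (e : 'I_n -> U) (l : 'I_n -> dual U),
    forall u, u = \sum_i l i u *: e i.
Proof.
move=> [n [e spanU]].
have gl : linear (fun v : 'rV[R]_n => \sum_i v 0 i *: e i).
  move=> a v w; rewrite scaler_sumr -big_split; apply: eq_bigr => i _ /=.
  by rewrite !mxE scalerDl scalerA.
have gs u : exists v, linear_of gl v = u.
  have [c ->] := spanU u; exists (\row_i c i) => /=.
  by apply: eq_bigr => i _; rewrite mxE.
have K0 : linear_of gl 0 = 0 by rewrite linear0.
have KL a v w : linear_of gl v = 0 -> linear_of gl w = 0 ->
    linear_of gl (a *: v + w) = 0.
  by move=> ev ew; rewrite linearP ev ew scaler0 addr0.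
have [p [pK Kp]] := complement (@Subspace R _ [set v | linear_of gl v = 0]%classic K0 KL)
  (rV_finite_diml n).
have [s sE] := linear_factor gs pK.
have ll i : linear (fun u => s u 0 i : R^o).
  by move=> a u v; rewrite linearP !mxE.
exists n, e, (fun i => linear_of (ll i)) => u /=.
have [v ev] := gs u; rewrite -{2}ev sE -ev.
by apply/eqP; rewrite -subr_eq0 -[X in _ - X]/(linear_of gl (p v)) -linearB; apply/eqP/Kp.
Qed.

Lemma dual_sumE U (I : finType) (F : I -> dual U) u : (\sum_i F i) u = \sum_i F i u.
Proof. by elim/big_rec2: _ => //= i f b _ <-. Qed.

Lemma dual_expand U n (e : 'I_n -> U) (l : 'I_n -> dual U) :
  (forall u, u = \sum_i l i u *: e i) ->
  forall k : dual U, k = \sum_i (k (e i) : R) *: l i.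
Proof.
move=> el k; apply: dualP => u; rewrite {1}(el u) linear_sum dual_sumE.
by apply: eq_bigr => i _; rewrite linearZ; exact: mulrC.
Qed.

Lemma dual_reflexive U (L : {linear dual U -> R^o}) : finite_diml U ->
  exists u : U, forall l : dual U, L l = l u.
Proof.
move=> /dual_basis [n [e [l el]]].
exists (\sum_i (L (l i) : R) *: e i) => k.
rewrite {1}(dual_expand el k) !linear_sum; apply: eq_bigr => i _.
by rewrite !linearZ; exact: mulrC.
Qed.

(** Compose coordinate forms with the projection that has kernel S. *)
Lemma dual_separates U (S : subspace U) (u : U) : finite_diml U ->
  (forall l : dual U, (forall s, ss_set S s -> l s = 0) -> l u = 0) -> ss_set S u.
Proof.
move=> fU h; have [p [pS Sp]] := complement S fU.
have [n [e [l el]]] := dual_basis fU.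
suff pu : p u = 0 by have := Sp u; rewrite pu subr0.
rewrite (el (p u)) big1 // => i _.
rewrite (_ : l i (p u) = 0) ?scale0r //.
apply: (h (dual_map p (l i))) => s Ss /=.
by rewrite pS // linear0.
Qed.

Lemma dual_separates0 U (u : U) : finite_diml U ->
  (forall l : dual U, l u = 0) -> u = 0.
Proof.
move=> /dual_basis [n [e [l el]]] h; rewrite (el u) big1 // => i _.
by rewrite h scale0r.
Qed.

Lemma finite_diml_surj U W (u : {linear U -> W}) :
  (forall w, exists v, u v = w) -> finite_diml U -> finite_diml W.
Proof.
move=> us [n [e se]]; exists n, (fun i => u (e i)) => w.
have [v <-] := us w; have [c ->] := se v; exists c.
by rewrite linear_sum; apply: eq_bigr => i _; rewrite linearZ.
Qed.

Lemma finite_diml_inj U W (u : {linear U -> W}) :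
  (forall v, u v = 0 -> v = 0) -> finite_diml W -> finite_diml U.
Proof.
move=> ui fW.
have I0 : exists v, u v = 0 by exists 0; rewrite linear0.
have IL a w w' : (exists v, u v = w) -> (exists v, u v = w') ->
    exists v, u v = a *: w + w'.
  by move=> [v <-] [v' <-]; exists (a *: v + v'); rewrite linearP.
have [p [pI Ip]] := complement (@Subspace R _ [set w | exists v, u v = w]%classic I0 IL) fW.
have [r rE] := choice Ip.
have uinj : injective u.
  by move=> v w e; apply/eqP; rewrite -subr_eq0; apply/eqP/ui; rewrite linearB e subrr.
have rl : linear r.
  move=> a w w'; apply: uinj; rewrite linearP !rE linearP opprD addrACA.
  by rewrite -scalerBr.
apply: (@finite_diml_surj _ _ (linear_of rl) _ fW) => v; exists (u v) => /=.
by apply: uinj; rewrite rE pI ?subr0 //; exists v.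
Qed.

Lemma finite_diml_dual U : finite_diml U -> finite_diml (dual U).
Proof.
move=> /dual_basis [n [e [l el]]]; exists n, l => k.
by exists (fun i => k (e i)); exact: dual_expand.
Qed.

Lemma finite_diml_span_subspace U (S : subspace U) : finite_diml U ->
  exists (n : nat) (e : 'I_n -> U), (forall i, ss_set S (e i)) /\
    forall u, ss_set S u -> exists c : 'I_n -> R, u = \sum_i c i *: e i.
Proof.
move=> fU; have [p [pS Sp]] := complement S fU.
have [n [e se]] := fU.
exists n, (fun i => e i - p (e i)); split=> // u Su.
have [c ec] := se u; exists c.
transitivity (u - p u); first by rewrite pS ?subr0.
rewrite ec linear_sum -sumrB; apply: eq_bigr => i _.
by rewrite linearZ scalerBr.
Qed.

Lemma finite_diml_ffun (T : finType) : finite_diml {ffun T -> R^o}.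
Proof.
pose f (v : 'rV[R]_#|T|) : {ffun T -> R^o} := [ffun t => v 0 (enum_rank t)].
have fl : linear f by move=> a u v; apply/ffunP => t; rewrite !ffunE !mxE.
apply: (@finite_diml_surj _ _ (linear_of fl) _ (rV_finite_diml _)) => w.
exists (\row_i w (enum_val i)); apply/ffunP => t /=.
by rewrite ffunE mxE enum_rankK.
Qed.
Lemma dprod_linearE (I : Type) (X : I -> lmodType R) a (u v : dprod X) i :
  (a *: u + v) i = a *: u i + v i.
Proof. by []. Qed.

Lemma finite_diml_dprod (I : finType) (X : I -> lmodType R) :
  (forall i, finite_diml (X i)) -> finite_diml (dprod X).
Proof.
move=> fX.
pose n i := projT1 (cid (fX i)); pose e i := projT1 (cid (projT2 (cid (fX i)))).
have se i : forall u, exists c : 'I_(n i) -> R, u = \sum_k c k *: e i k.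
  exact: projT2 (cid (projT2 (cid (fX i)))).
pose f (v : {ffun {i : I & 'I_(n i)} -> R^o}) : dprod X :=
  fun i => \sum_k (v (Tagged (fun i => 'I_(n i)) k) : R) *: e i k.
have fl : linear f.
  move=> a u v; apply: functional_extensionality_dep => i.
  rewrite [RHS]dprod_linearE /f scaler_sumr -big_split; apply: eq_bigr => k _.
  by rewrite !ffunE scalerDl scalerA.
apply: (@finite_diml_surj _ _ (linear_of fl) _ (finite_diml_ffun _)) => w.
pose c i := projT1 (cid (se i (w i))).
exists [ffun t => c (tag t) (tagged t)]; apply: functional_extensionality_dep => i.
rewrite [RHS](projT2 (cid (se i (w i)))); apply: eq_bigr => k _.
by rewrite ffunE.
Qed.

End LinearAlgebra.

(** * Representable modules and direct sums *)

Lemma finite_set_enum (T : Type) (A : set T) : finite_set A ->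
  exists (I : finType) (g : I -> T), forall x, A x -> exists i, g i = x.
Proof.
move=> [n /pcard_eqP/bijPex [f [fA finj _]]].
pose I := {k : 'I_n | `[< exists x, A x /\ f x = val k >]}.
have h (k : I) : exists x, A x /\ f x = val (val k) by have /asboolP := valP k.
have [g gP] := choice h.
exists I, g => x Ax.
have fx : (f x < n)%N by exact: fA.
have kP : `[< exists y, A y /\ f y = val (Ordinal fx) >] by apply/asboolP; exists x.
exists (exist _ (Ordinal fx) kP).
have [Ag eg] := gP (exist _ (Ordinal fx) kP).
by apply: finj; rewrite ?inE // eg.
Qed.

(** The last clause says that N is contained in every family of subspaces that
    contains the e i.  This avoids comparing vectors of the different spaces
    U x, and it is applied with N' the family of all vectors with a desired
    property. *)
Lemma finite_span (R : fieldType) (T : Type) (U : T -> lmodType R)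
    (N : forall x, subspace (U x)) :
  finite_set [set x | exists v : U x, v != 0]%classic ->
  (forall x, finite_diml (U x)) ->
  exists (I : finType) (x : I -> T) (e : forall i, U (x i)),
    (forall i, ss_set (N (x i)) (e i)) /\
    forall N' : forall x, subspace (U x),
      (forall i, ss_set (N' (x i)) (e i)) ->
      forall y u, ss_set (N y) u -> ss_set (N' y) u.
Proof.
move=> /finite_set_enum [J [g gP]] fU.
pose h i := cid (finite_diml_span_subspace (N (g i)) (fU (g i))).
pose n i := projT1 (h i); pose e i := projT1 (cid (projT2 (h i))).
have eP i : (forall k, ss_set (N (g i)) (e i k)) /\
    forall u, ss_set (N (g i)) u -> exists c : 'I_(n i) -> R, u = \sum_k c k *: e i k.
  exact: projT2 (cid (projT2 (h i))).
exists {i : J & 'I_(n i)}, (fun t => g (tag t)), (fun t => e (tag t) (tagged t)).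
split=> [t|N' N'e y u Nu]; first exact: (eP _).1.
have [->|u0] := eqVneq u 0; first exact: ss0.
have [|i ei] := gP y; first by exists u.
subst y; have [c ->] := (eP i).2 u Nu.
by apply: ss_sum => k; apply: ssZ; exact: (N'e (Tagged (fun i => 'I_(n i)) k)).
Qed.

Section Representables.
Variables (R : fieldType) (D : fincat).
Local Notation P := (@repr_mod R D).
Local Notation dmod := (dmod R D).

Definition torsion_free (V : dmod) : Prop :=
  forall x y (f : hom x y) v, act V f v = 0 -> v = 0.

Definition repr_basis (x y : D) (f : hom x y) : P x y := [ffun g => (f == g)%:R].

Lemma repr_basis_act (x y z : D) (f : hom x y) (g : hom y z) :
  act (P x) g (repr_basis f) = repr_basis (g \om f).
Proof.
apply/ffunP => h; rewrite !ffunE big_mkcond (bigD1 f) //= ffunE eqxx big1.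
  by rewrite addr0; case: eqP.
by move=> k kf; rewrite ffunE [_ == k]eq_sym (negbTE kf) if_same.
Qed.

Lemma repr_expand (x y : D) (p : P x y) : p = \sum_f (p f : R) *: repr_basis f.
Proof.
apply/ffunP => g; rewrite sum_ffunE (bigD1 g) //= !ffunE eqxx big1.
  by rewrite addr0; exact: esym (mulr1 _).
by move=> f /negbTE fg; rewrite !ffunE fg; exact: mulr0.
Qed.

Section Yoneda.
Variables (V : dmod) (x : D).

Definition yoneda_fun (v : V x) (y : D) (p : P x y) : V y :=
  \sum_f (p f : R) *: act V f v.

Lemma yoneda_linear v y : linear (@yoneda_fun v y).
Proof.
move=> a p q; rewrite /yoneda_fun scaler_sumr -big_split.
by apply: eq_bigr => f _; rewrite !ffunE scalerDl scalerA.
Qed.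

Lemma yoneda_act v (y z : D) (g : hom y z) p :
  yoneda_fun v (act (P x) g p) = act V g (yoneda_fun v p).
Proof.
rewrite /yoneda_fun linear_sum.
under [RHS]eq_bigr => f _ do rewrite linearZ /= -actM.
rewrite (partition_big (fun f => g \om f) xpredT) //=; apply: eq_bigr => h _.
rewrite ffunE scaler_suml; apply: eq_bigr => f /eqP <-; by [].
Qed.

Definition yoneda (v : V x) : mhom (P x) V :=
  MHom (yoneda_linear v) (yoneda_act v).

Lemma yoneda_basis v y (f : hom x y) : yoneda v y (repr_basis f) = act V f v.
Proof.
rewrite /= /yoneda_fun (bigD1 f) //= ffunE eqxx scale1r big1 ?addr0 // => g /negbTE gf.
by rewrite ffunE eq_sym gf scale0r.
Qed.

Lemma yoneda_idm v : yoneda v x (repr_basis (idm x)) = v.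
Proof. by rewrite yoneda_basis act1. Qed.

Lemma repr_mhomP (u u' : mhom (P x) V) :
  u x (repr_basis (idm x)) = u' x (repr_basis (idm x)) -> u = u'.
Proof.
move=> e; apply: mhomP => y p; rewrite [p]repr_expand !linear_sum.
apply: eq_bigr => f _; rewrite !linearZ; congr (_ *: _).
have ug (w : mhom (P x) V) : w y (repr_basis f) = act V f (w x (repr_basis (idm x))).
  by rewrite -mfun_act repr_basis_act hcompm1.
by rewrite [LHS]ug [RHS]ug e.
Qed.
End Yoneda.

Lemma mhom_sumE (V W : dmod) (I : finType) (F : I -> mhom V W) x (v : V x) :
  (\sum_i F i) x v = \sum_i F i x v.
Proof. by elim/big_rec2: _ => //= i f b _ <-. Qed.

Lemma mhom_scaleE (V W : dmod) a (f : mhom V W) x (v : V x) :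
  (a *: f) x v = a *: f x v.
Proof. by []. Qed.

Lemma precomp_basis (x y z : D) (f : hom x y) (g : hom y z) :
  precomp R f z (repr_basis g) = repr_basis (g \om f).
Proof.
apply/ffunP => h; rewrite !ffunE big_mkcond (bigD1 g) //= ffunE eqxx big1.
  by rewrite addr0; case: eqP.
by move=> k kf; rewrite ffunE [_ == k]eq_sym (negbTE kf) if_same.
Qed.

(** Linear Yoneda: naturality with respect to precompositions is therefore
    naturality with respect to all maps between representables. *)
Lemma repr_mhom_expand (x y : D) (u : mhom (P y) (P x)) :
  u = \sum_f (u y (repr_basis (idm y)) f : R) *: precomp R f.
Proof.
apply: repr_mhomP; rewrite mhom_sumE [LHS]repr_expand; apply: eq_bigr => f _.
by rewrite mhom_scaleE precomp_basis hcomp1m.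
Qed.

Lemma repr_projective (x : D) : projective (P x).
Proof.
move=> V W u p us; have [v ev] := us x (p x (repr_basis (idm x))).
by exists (yoneda v); apply: repr_mhomP; rewrite -ev -[in RHS](yoneda_idm v).
Qed.

(** Postcomposition with a monomorphism is injective on the basis. *)
Lemma repr_torsion_free (x : D) :
  (forall (y z : D) (f : hom y z), monomorphism f) -> torsion_free (P x).
Proof.
move=> mono y z f p e; apply/ffunP => g.
have := congr1 (fun q : P x z => q (f \om g)) e; rewrite !ffunE => <-.
rewrite (bigD1 g) //= big1 ?addr0 // => h /andP[/eqP /mono ->].
by rewrite eqxx.
Qed.

Section DirectSums.
Variables (I : finType) (X : I -> dmod).

Definition dsum_pr (i : I) : mhom (dsum X) (X i).
Proof. by refine (@MHom R D (dsum X) (X i) (fun x v => v i) _ _). Defined.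

Definition dsum_in_fun (i : I) (x : D) (v : X i x) : dsum X x :=
  dfwith (fun j => 0 : X j x) v.

Lemma dsum_in_linear i x : linear (@dsum_in_fun i x).
Proof.
move=> a u v; apply: functional_extensionality_dep => j.
rewrite [RHS]dprod_linearE /dsum_in_fun.
have [<-|ij] := eqVneq i j; first by rewrite !dfwith_in.
by rewrite !dfwith_out // scaler0 addr0.
Qed.

Lemma dsum_in_act i x y (f : hom x y) (v : X i x) :
  dsum_in_fun (act (X i) f v) = act (dsum X) f (dsum_in_fun v).
Proof.
apply: functional_extensionality_dep => j; rewrite /= /dsum_act /dsum_in_fun.
have [<-|ij] := eqVneq i j; first by rewrite !dfwith_in.
by rewrite !dfwith_out // linear0.
Qed.

Definition dsum_in i : mhom (X i) (dsum X) :=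
  MHom (@dsum_in_linear i) (@dsum_in_act i).

Lemma dsum_prK i x (v : X i x) : dsum_pr i x (dsum_in i x v) = v.
Proof. exact: dfwith_in. Qed.

Lemma dsum_pr_in i k x (v : X i x) : i != k -> dsum_pr k x (dsum_in i x v) = 0.
Proof. exact: dfwith_out. Qed.

Lemma dprod_sumE (x : D) (J : finType) (F : J -> dsum X x) i :
  (\sum_j F j) i = \sum_j F j i.
Proof. by elim/big_rec2: _ => //= j f b _ <-. Qed.

Lemma dsum_expand x (v : dsum X x) : v = \sum_i dsum_in i x (v i).
Proof.
apply: functional_extensionality_dep => i; rewrite dprod_sumE.
rewrite (bigD1 i) //= /dsum_in_fun dfwith_in big1 ?addr0 // => j ji.
by rewrite dfwith_out.
Qed.

Lemma dsum_mhomE W (u : mhom (dsum X) W) x (v : dsum X x) :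
  u x v = \sum_i u x (dsum_in i x (v i)).
Proof. by rewrite {1}(dsum_expand v) linear_sum. Qed.

Lemma dsum_pair_linear W (u : forall i, mhom W (X i)) x :
  linear (fun w : W x => (fun i => u i x w) : dsum X x).
Proof.
by move=> a v w; apply: functional_extensionality_dep => i; rewrite linearP.
Qed.

Lemma dsum_pair_act W (u : forall i, mhom W (X i)) x y (f : hom x y) (w : W x) :
  ((fun i => u i y (act W f w)) : dsum X y) = act (dsum X) f (fun i => u i x w).
Proof.
by apply: functional_extensionality_dep => i; rewrite mfun_act.
Qed.

Definition dsum_pair W (u : forall i, mhom W (X i)) : mhom W (dsum X) :=
  MHom (dsum_pair_linear u) (dsum_pair_act u).

Lemma dsum_torsion_free : (forall i, torsion_free (X i)) -> torsion_free (dsum X).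
Proof.
move=> tf x y f v e; apply: functional_extensionality_dep => i.
by apply: (tf i _ _ f); exact: (congr1 (fun w : dsum X y => w i) e).
Qed.

Lemma dsum_injective : (forall i, injective_mod (X i)) -> injective_mod (dsum X).
Proof.
move=> inj V W u p ui.
have h i : exists q : mhom W (X i), mcomp q u = mcomp (dsum_pr i) p by exact: inj.
exists (dsum_pair (fun i => projT1 (cid (h i)))); apply: mhomP => x v.
apply: functional_extensionality_dep => i.
exact: (congr1 (fun m : mhom V (X i) => m x v) (projT2 (cid (h i)))).
Qed.
End DirectSums.

End Representables.

(** * Factorizations, saturated submodules and quotients *)

Section Modules.
Variables (R : fieldType) (D : fincat).
Local Notation P := (@repr_mod R D).
Local Notation dmod := (dmod R D).

Lemma mhom_eqE (V W : dmod) (u v : mhom V W) : u = v -> forall x w, u x w = v x w.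
Proof. by move=> ->. Qed.

Lemma minjective0 (V W : dmod) (u : mhom V W) :
  (forall x v, u x v = 0 -> v = 0) -> minjective u.
Proof.
move=> u0 x v w e; apply/eqP; rewrite -subr_eq0; apply/eqP/u0.
by rewrite linearB /= e subrr.
Qed.

Lemma submod_incl_inj (V : dmod) (S : submod V) : minjective (submod_incl S).
Proof. by move=> x v w; exact: val_inj. Qed.

Lemma submod_memP (V : dmod) (S : submod V) x (v : submodule S x) :
  ss_set (S x) (submod_incl S x v).
Proof. by have := valP v; rewrite inE. Qed.

Lemma submod_mem (V : dmod) (S : submod V) x (v : V x) :
  ss_set (S x) v -> exists w, submod_incl S x w = v.
Proof. by rewrite -inE => h; exists (Sub v h). Qed.

Lemma mono_lift (W Q X : dmod) (j : mhom W Q) (g : mhom X Q) :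
  minjective j -> (forall x v, exists w, j x w = g x v) ->
  exists h : mhom X W, mcomp j h = g.
Proof.
move=> ji /= gj.
pose h x v := projT1 (cid (gj x v)).
have hE x v : j x (h x v) = g x v by exact: projT2 (cid (gj x v)).
have hl x : linear (h x) by move=> a v w; apply: ji; rewrite linearP /= !hE linearP.
have ha x y (f : hom x y) v : h y (act X f v) = act W f (h x v).
  by apply: ji; rewrite mfun_act !hE mfun_act.
by exists (MHom hl ha); apply: mhomP => x v; exact: hE.
Qed.

Section Image.
Variables (V W : dmod) (u : mhom V W).

Definition image_subspace (x : D) : subspace (W x).
Proof.
refine (@Subspace R (W x) [set w | exists v, u x v = w]%classic _ _).
- by exists 0; rewrite linear0.
- by move=> a _ _ [v <-] [w <-]; exists (a *: v + w); rewrite linearP.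
Defined.

Definition image_submod : submod W.
Proof.
refine (@Submod R D W image_subspace _) => x y f _ [v <-].
by exists (act V f v); rewrite mfun_act.
Defined.
End Image.

(** The map induced by f on the image of u extends to W.  For u injective this
    is the definition of injectivity of Q. *)
Lemma injective_factor (V W Q : dmod) (u : mhom V W) (f : mhom V Q) :
  injective_mod Q -> (forall x v, u x v = 0 -> f x v = 0) ->
  exists g : mhom W Q, mcomp g u = f.
Proof.
move=> inj ker.
have fE x v w : u x v = u x w -> f x v = f x w.
  move=> e; apply/eqP; rewrite -subr_eq0 -linearB; apply/eqP/ker.
  by rewrite linearB /= e subrr.
pose S := image_submod u.
pose r x (w : submodule S x) := projT1 (cid (submod_memP w)).
have rE x (w : submodule S x) : u x (r x w) = submod_incl S x w.
  exact: projT2 (cid (submod_memP w)).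
pose f' x (w : submodule S x) := f x (r x w).
have f'l x : linear (f' x).
  by move=> a v w; rewrite /f' -linearP; apply: fE; rewrite linearP /= !rE.
have f'a x y (h : hom x y) v : f' y (act (submodule S) h v) = act Q h (f' x v).
  by rewrite /f' -mfun_act; apply: fE; rewrite mfun_act !rE.
have [g gE] := inj _ _ _ (MHom f'l f'a) (@submod_incl_inj _ S).
exists g; apply: mhomP => x v.
have [w ew] : exists w, submod_incl S x w = u x v by apply: submod_mem; exists v.
rewrite /= -ew; rewrite [LHS](mhom_eqE gE w) /= /f'.
by apply: fE; rewrite rE.
Qed.

(** The second clause says that the cokernel of j is torsion free. *)
Definition saturated (W Q : dmod) (j : mhom W Q) : Prop :=
  minjective j /\ forall x y (f : hom x y) q w, act Q f q = j y w ->
    exists w', j x w' = q.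

Lemma torsion_free_sub (W Q : dmod) (j : mhom W Q) :
  minjective j -> torsion_free Q -> torsion_free W.
Proof.
move=> ji tQ x y f w e; apply: (ji x); rewrite linear0.
by apply: (tQ _ _ f); rewrite -mfun_act e linear0.
Qed.

Lemma torsion_iso_cancel (V X W : dmod) (s : mhom V X) (g g' : mhom X W) :
  torsion_free W -> torsion_iso s -> mcomp g s = mcomp g' s -> g = g'.
Proof.
move=> tW [_ cs] /mhom_eqE e; apply: mhomP => x w.
have [y [f [v ev]]] := cs x w.
apply/eqP; rewrite -subr_eq0; apply/eqP/(tW _ _ f).
rewrite linearB /= -!mfun_act ev; apply/eqP; rewrite subr_eq0; apply/eqP.
exact: e.
Qed.

(** The map to Q kills the kernel of s, which is torsion, so it extends along
    s; and it sends X into W because a translate of each element of X comes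
    from V and W is saturated. *)
Lemma torsion_iso_lift (V X W Q : dmod) (s : mhom V X) (j : mhom W Q) :
  injective_mod Q -> torsion_free Q -> saturated j -> torsion_iso s ->
  forall f : mhom V W, exists g : mhom X W, mcomp g s = f.
Proof.
move=> iQ tQ [ji js] [ks cs] f.
have [|g gE] := @injective_factor V X Q s (mcomp j f) iQ.
  move=> x v /ks [y [h e]]; apply: (tQ _ _ h).
  by rewrite -mfun_act e linear0.
have [|h hE] := @mono_lift W Q X j g ji.
  move=> x v; have [y [h [w e]]] := cs x v.
  apply: (js x y h _ (f y w)).
  by rewrite -mfun_act e; exact: (mhom_eqE gE).
exists h; apply: mhomP => x v; apply: ji.
by rewrite -[RHS](mhom_eqE gE v); exact: (mhom_eqE hE).
Qed.

Lemma fg_quotient (V W : dmod) (u : mhom V W) :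
  msurjective u -> finitely_generated V -> finitely_generated W.
Proof.
move=> us [I [x [p ps]]]; exists I, x, (mcomp u p) => y w.
by have [v <-] := us y w; have [q <-] := ps y v; exists q.
Qed.

Lemma dsum_repr_fg (I : finType) (x : I -> D) :
  finitely_generated (dsum (fun i => P (x i))).
Proof. by exists I, x, (mid _) => y w; exists w. Qed.

Lemma fg_finite_diml (V : dmod) : finitely_generated V -> forall x, finite_diml (V x).
Proof.
move=> [I [x [p ps]]] y; apply: (@finite_diml_surj _ _ _ (p y)) (ps y) _.
by apply: finite_diml_dprod => i; exact: finite_diml_ffun.
Qed.

(** The values of V are finite dimensional, so the quotient can be carried by
    the image of a projection with kernel S instead of by cosets. *)
Section QuotientModule.
Variables (V : dmod) (S : submod V).
Hypothesis fV : forall x, finite_diml (V x).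

Let p x : {linear V x -> V x} := projT1 (cid (complement (S x) (fV x))).

Let pS x v : ss_set (S x) v -> p x v = 0.
Proof. exact: (projT2 (cid (complement (S x) (fV x)))).1. Qed.

Let Sp x v : ss_set (S x) (v - p x v).
Proof. exact: (projT2 (cid (complement (S x) (fV x)))).2. Qed.

Let p_idem x v : p x (p x v) = p x v.
Proof. by have /eqP := pS (Sp v); rewrite linearB subr_eq0 => /eqP <-. Qed.

Definition quotient_subspace (x : D) : subspace (V x).
Proof.
refine (@Subspace R (V x) [set v | p x v = v]%classic _ _) => /=.
- exact: linear0.
- by move=> a u v eu ev; rewrite linearP eu ev.
Defined.

Let T x := subsp (quotient_subspace x).

Let proj x (v : V x) : T x.
Proof. by exists (p x v); rewrite inE /= p_idem. Defined.

Let proj_linear x : linear (@proj x).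
Proof. by move=> a u v; apply: val_inj; exact: linearP. Qed.

Let proj_act x y (f : hom x y) (v : V x) :
  proj (act V f (p x v)) = proj (act V f v).
Proof.
have /eqP := pS (sm_act f (Sp v)); rewrite !linearB subr_eq0 => /eqP e.
by apply: val_inj; exact: esym e.
Qed.

Definition quotient_module : dmod.
Proof.
refine (@DMod R D T (fun x y f v => proj (act V f (val v))) _ _ _).
- by move=> x y f a u v; apply: val_inj; rewrite /= !linearP.
- by move=> x v; apply: val_inj; rewrite /= act1; have := valP v; rewrite inE.
- by move=> x y z g f v; rewrite actM; exact: esym (proj_act _ _).
Defined.

Definition quotient_map : mhom V quotient_module.
Proof.
refine (@MHom R D V quotient_module proj proj_linear _).
by move=> x y f v; exact: esym (proj_act _ _).
Defined.

Lemma quotient_map_surj : msurjective quotient_map.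
Proof.
by move=> x w; exists (val w); apply: val_inj => /=; have := valP w; rewrite inE.
Qed.

Lemma quotient_map_eq0 x v : quotient_map x v = 0 <-> ss_set (S x) v.
Proof.
split=> [/(congr1 val) /= e|Sv]; first by have := Sp v; rewrite e subr0.
by apply: val_inj; exact: pS.
Qed.
End QuotientModule.

End Modules.

(** * Cogeneration by representables *)

Section HomSpaces.
Variables (R : fieldType) (D : fincat).
Local Notation P := (@repr_mod R D).
Local Notation dmod := (dmod R D).

Lemma fg_mhom_eq0 (V X : dmod) (I : finType) (x : I -> D)
    (u : mhom (dsum (fun i => P (x i))) V) (c : mhom V X) : msurjective u ->
  (forall i, c _ (u _ (dsum_in (fun i => P (x i)) i _ (repr_basis R (idm (x i))))) = 0) -> c = 0.
Proof.
move=> us h; apply: mhomP => y v; have [q <-] := us y v.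
rewrite dsum_mhomE linear_sum big1 // => i _.
have : mcomp c (mcomp u (dsum_in (fun i => P (x i)) i)) = 0.
  by apply: repr_mhomP => /=; exact: h.
by move/mhom_eqE; apply.
Qed.

Lemma fg_hom_finite_diml (V : dmod) (x : D) :
  finitely_generated V -> finite_diml (mhom V (P x)).
Proof.
move=> [I [y [u us]]].
pose ev (c : mhom V (P x)) : dprod (fun i => P x (y i)) :=
  fun i => c _ (u _ (dsum_in (fun i => P (y i)) i _ (repr_basis R (idm (y i))))).
have evl : linear ev by move=> a c d; exact: functional_extensionality_dep.
apply: (@finite_diml_inj _ _ _ (linear_of evl)).
  move=> c /= e; apply: (fg_mhom_eq0 us) => i.
  exact: (congr1 (fun f : dprod (fun i => P x (y i)) => f i) e).
by apply: finite_diml_dprod => i; exact: finite_diml_ffun.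
Qed.

(** A map from V to P x is determined by the images of the generators of V,
    which are combinations of morphisms from x to the objects carrying these
    generators. *)
Lemma fg_hom_support (V : dmod) :
  (forall x : D, finite_set [set y : D | inhabited (hom y x)]%classic) ->
  finitely_generated V ->
  finite_set [set x | exists c : mhom V (P x), c != 0]%classic.
Proof.
move=> fin [I [y [u us]]].
apply: (@sub_finite_set _ _
  (\bigcup_(i in [set: I]) [set x : D | inhabited (hom x (y i))])%classic).
  move=> x [c /eqP c0] /=; apply: contrapT => h; apply: c0.
  apply: (fg_mhom_eq0 us) => i; apply/ffunP => f.
  by case: h; exists i.
by apply: bigcup_finite => // i _; exact: fin.
Qed.
End HomSpaces.

Section Cogeneration.
Variables (R : fieldType) (D : fincat).
Local Notation P := (@repr_mod R D).
Local Notation dmod := (dmod R D).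
Hypothesis typeD : typeII D.
Hypotheses (hLN : LN R D) (hLS : LS R D) (hNV : NV R D).

Lemma repr_injective x : injective_mod (P x).
Proof. by apply: hLS; exact: repr_projective. Qed.

Lemma dsum_repr_injective (I : finType) (x : I -> D) :
  injective_mod (dsum (fun i => P (x i))).
Proof. by apply: dsum_injective => i; exact: repr_injective. Qed.

Lemma dsum_repr_torsion_free (I : finType) (x : I -> D) :
  torsion_free (dsum (fun i => P (x i))).
Proof. by apply: dsum_torsion_free => i; apply: repr_torsion_free; exact: typeII_mono. Qed.

Definition annihilated_subspace (V : dmod) (z : D) : subspace (V z).
Proof.
refine (@Subspace R (V z) [set v | forall x (c : mhom V (P x)), c z v = 0]%classic _ _).
- by move=> x c; rewrite linear0.
- by move=> a u v hu hv x c; rewrite linearP /= hu hv scaler0 addr0.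
Defined.

Definition annihilated (V : dmod) : submod V.
Proof.
refine (@Submod R D V (annihilated_subspace V) _) => x y f v h z c.
by rewrite mfun_act h linear0.
Defined.

(** The only place where (NV) enters: injectivity of P x turns a nonzero map on
    a submodule into a map on V that is nonzero on this submodule. *)
Lemma annihilated_torsion (V : dmod) z (v : V z) : finitely_generated V ->
  (forall x (c : mhom V (P x)), c z v = 0) ->
  exists (y : D) (f : hom z y), act V f v = 0.
Proof.
move=> fV hv; pose K := annihilated V.
have [tK|ntK] := pselect (torsion (submodule K)).
  have [w ew] := submod_mem (hv : ss_set (K z) v).
  have [y [f e]] := tK z w.
  by exists y, f; rewrite -ew -mfun_act e linear0.
have [x [u u0]] := hNV (hLN fV K) ntK; case: u0.
have [c cE] := repr_injective u (@submod_incl_inj _ _ _ K).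
apply: mhomP => y w; rewrite -cE; exact: (submod_memP w).
Qed.

(** Finitely many c in N span N, by [finite_span] applied to the family of all
    maps that kill a given v. *)
Lemma fg_jointly_spanning (V : dmod) (N : forall x, subspace (mhom V (P x))) :
  finitely_generated V ->
  exists (I : finType) (x : I -> D) (e : forall i, mhom V (P (x i))),
    (forall i, ss_set (N (x i)) (e i)) /\
    forall z (v : V z), (forall i, e i z v = 0) ->
      forall x c, ss_set (N x) c -> c z v = 0.
Proof.
move=> fV.
have [I [x [e [Ne eN]]]] := finite_span N (fg_hom_support (typeII_finite typeD) fV)
  (fun x => fg_hom_finite_diml x fV).
exists I, x, e; split=> // z v ev.
have Z0 y : (0 : mhom V (P y)) z v = 0 by [].
have ZL y a (c d : mhom V (P y)) : c z v = 0 -> d z v = 0 -> (a *: c + d) z v = 0.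
  by move=> /= -> ->; rewrite scaler0 addr0.
exact: (eN (fun y => @Subspace R _ [set c : mhom V (P y) | c z v = 0]%classic (Z0 y) (ZL y))).
Qed.

Lemma fg_torsion_kernel (V : dmod) : finitely_generated V ->
  exists (I : finType) (x : I -> D) (j : mhom V (dsum (fun i => P (x i)))),
    forall z v, j z v = 0 -> exists (y : D) (f : hom z y), act V f v = 0.
Proof.
move=> fV.
have [I [x [e [_ eN]]]] := fg_jointly_spanning
  (fun x => @Subspace R (mhom V (P x)) setT I (fun _ _ _ _ _ => I)) fV.
exists I, x, (dsum_pair e) => z v ev; apply: annihilated_torsion => // y c.
apply: eN => // i; exact: (congr1 (fun w : dsum (fun i => P (x i)) z => w i) ev).
Qed.

Lemma fg_torsion_free_embeds (V : dmod) : finitely_generated V -> torsion_free V ->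
  exists (I : finType) (x : I -> D) (j : mhom V (dsum (fun i => P (x i)))), minjective j.
Proof.
move=> fV tV; have [I [x [j jt]]] := fg_torsion_kernel fV; exists I, x, j.
by apply: minjective0 => z v /jt [y [f]]; exact: tV.
Qed.

(** The elements of Q killed by the maps that vanish on W are torsion modulo W,
    by the previous principle applied to the quotient of Q by W. *)
Lemma saturated_cogenerated (W Q : dmod) (j : mhom W Q) z (q : Q z) :
  finitely_generated Q -> saturated j ->
  (forall x (c : mhom Q (P x)), mcomp c j = 0 -> c z q = 0) ->
  exists w, j z w = q.
Proof.
move=> fQ [ji js] h; pose S := image_submod j; have fz := fg_finite_diml fQ.
have fq := fg_quotient (@quotient_map_surj _ _ _ S fz) fQ.
have [|y [f]] := @annihilated_torsion _ z (quotient_map S fz z q) fq.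
  move=> x c; apply: (h x (mcomp c (quotient_map S fz))).
  apply: mhomP => y w; apply: etrans (linear0 (c y)); congr (c y _).
  by apply/quotient_map_eq0; exists w.
by rewrite -mfun_act => /quotient_map_eq0 [w ew]; exact: (js z y f q w (esym ew)).
Qed.

End Cogeneration.

Section Saturation.
Variables (R : fieldType) (D : fincat) (ore : left_ore D).
Variables (V Q : dmod R D) (j : mhom V Q).

(** The elements of Q with a translate in the image of V; closed under addition
    by the Ore condition. *)
Definition saturation_subspace (x : D) : subspace (Q x).
Proof.
refine (@Subspace R (Q x)
  [set q | exists y (f : hom x y) v, act Q f q = j y v]%classic _ _).
- by exists x, (idm x), 0; rewrite !linear0.
- move=> a p q [y [f [v ev]]] [y' [f' [v' ev']]].
  have [z [g [g' e]]] := ore f f'.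
  exists z, (g \om f), (a *: act V g v + act V g' v').
  by rewrite !linearP /= actM ev e actM ev' !mfun_act.
Defined.

Definition saturation : submod Q.
Proof.
refine (@Submod R D Q saturation_subspace _) => x y h q [z [f [v e]]].
have [w [g [g' eg]]] := ore f h.
by exists w, g', (act V g v); rewrite -actM -eg actM e mfun_act.
Defined.

Lemma saturation_saturated : saturated (submod_incl saturation).
Proof.
split=> [|x y f q w e]; first exact: submod_incl_inj.
apply: submod_mem; have [z [g [v ev]]] := submod_memP w.
by exists z, (g \om f), v; rewrite actM e.
Qed.

Lemma saturation_torsion_iso :
  (forall x v, j x v = 0 -> exists (y : D) (f : hom x y), act V f v = 0) ->
  exists s : mhom V (submodule saturation),
    mcomp (submod_incl saturation) s = j /\ torsion_iso s.
Proof.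
move=> jt.
have [|s sE] := mono_lift (j := submod_incl saturation) (g := j) (@submod_incl_inj _ _ _ _).
  by move=> x v; apply: submod_mem; exists x, (idm x), v; rewrite act1.
exists s; split=> //; split=> x v.
  by move=> sv; apply: jt; rewrite -(mhom_eqE sE) /= sv.
have [y [f [w e]]] := submod_memP v; exists y, f, w.
apply: (@submod_incl_inj _ _ _ saturation).
by rewrite mfun_act e; exact: esym (mhom_eqE sE w).
Qed.
End Saturation.

(** * Sheaves for the atomic topology *)

Section AtomicSheaves.
Variables (R : fieldType) (C : fincat) (ore : left_ore (op C)).
Local Notation dmod := (dmod R (op C)).
Local Notation P := (@repr_mod R (op C)).
Local Notation homC := (@hom C).
Local Notation hom := (@hom (op C)).
Local Notation atomic_sheaf V := (sheaf (atomic_topology ore) (underlying_presheaf V)).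

(** If f kills v, then v and 0 agree on the sieve of all g that kill v. *)
Lemma sheaf_torsion_free (V : dmod) : atomic_sheaf V -> torsion_free V.
Proof.
move=> shV x y f v fv.
pose S := @Sieve C x (fun z (g : homC z x) => act V g v = 0)
  (fun z w (g : homC z x) (h : homC w z) (e : act V g v = 0) =>
     etrans (@actM R (op C) V x z w h g v) (etrans (congr1 _ e) (linear0 _))).
have [|a [_ a_uniq]] := shV x S (ex_intro _ y (ex_intro _ f fv)) (fun z g _ => 0).
  by move=> z w g h Sg Sgh; exact: esym (linear0 _).
have a0 : a = 0 by apply: a_uniq => z g _; exact: linear0.
by rewrite -a0; apply/esym/a_uniq.
Qed.

(** For q with a translate in V, the g that move q into V form a covering
    sieve, and the translates of q are a matching family on it.  It glues to an
    element of V that can only be q, as Q is torsion free. *)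
Lemma sheaf_saturated (V Q : dmod) (j : mhom V Q) :
  torsion_free Q -> minjective j -> atomic_sheaf V -> saturated j.
Proof.
move=> tQ ji shV; split=> // x y f q w e.
have Scomp z z' (g : homC z x) (h : homC z' z) :
    (exists v, j z v = act Q g q) -> exists v, j z' v = act Q (@hcomp C _ _ _ g h : hom x z') q.
  move=> [v ev]; exists (act V (h : hom z z') v).
  by rewrite mfun_act ev; exact: esym (@actM R (op C) Q x z z' h g q).
pose S := @Sieve C x (fun z (g : homC z x) => exists v, j z v = act Q g q) Scomp.
pose s z (g : homC z x) (Sg : S z g) : V z := projT1 (cid Sg).
have sE z (g : homC z x) (Sg : S z g) : j z (s z g Sg) = act Q (g : hom x z) q.
  exact: projT2 (cid Sg).
have [||a [aE _]] := shV x S _ s.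
- by exists y, f, w.
- move=> z z' g h Sg Sgh; apply: ji.
  rewrite sE /=; apply: etrans (@actM R (op C) Q x z z' h g q) _.
  by rewrite mfun_act sE.
have Sf : S y f by exists w.
exists a; apply/eqP; rewrite -subr_eq0; apply/eqP; apply: (tQ _ _ f).
rewrite linearB /= -mfun_act; apply/eqP; rewrite subr_eq0; apply/eqP.
by have /= -> := aE y f Sf; rewrite sE.
Qed.

Section SieveModule.
Variables (x : C) (S : sieve x).

Definition sieve_subspace (y : op C) : subspace (P x y).
Proof.
refine (@Subspace R (P x y) [set p | forall f, p f != 0 -> S y f]%classic _ _).
- by move=> f; rewrite ffunE eqxx.
- move=> a p q Sp Sq f; rewrite !ffunE.
  have [->|/Sp //] := eqVneq (p f) 0.
  by rewrite scaler0 add0r; exact: Sq.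
Defined.

(** The linearization of the sieve S: a matching family on S is the same as a
    map from this module. *)
Definition sieve_submod : submod (P x).
Proof.
refine (@Submod R (op C) (P x) sieve_subspace _) => y z g p Sp k; rewrite ffunE => k0.
have [f /eqP <- pf] : exists2 f, hcomp g f == k & p f != 0.
  apply: contrapT => h; move/eqP: k0; apply; rewrite big1 // => f fk.
  by apply/eqP/negPn/negP => pf; apply: h; exists f.
exact: (@sv_comp C x S y z f g (Sp f pf)).
Defined.
End SieveModule.

(** A matching family is a map from the linearized sieve to V.  It extends to
    a map from P x to Q by injectivity, and the image of the generator is the
    glued element: it lies in V because one of its translates does. *)
Lemma saturated_sheaf (V Q : dmod) (j : mhom V Q) :
  injective_mod Q -> torsion_free Q -> saturated j -> atomic_sheaf V.
Proof.
move=> iQ tQ [ji js] x S [y0 [f0 Sf0]] s ms.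
(* Extending s by 0 outside of S makes it a function on all morphisms. *)
pose s' z (g : homC z x) : V z :=
  if pselect (S z g) is left Sg then s z g Sg else 0.
have s'E z g (Sg : S z g) : s' z g = s z g Sg.
  by rewrite /s'; case: pselect => // Sg'; congr (s _ _ _); exact: Prop_irrelevance.
pose h z (p : submodule (sieve_submod S) z) : V z := \sum_f (val p f : R) *: s' z f.
have hl z : linear (h z).
  move=> a p q; rewrite /h scaler_sumr -big_split /=.
  by apply: eq_bigr => f _; rewrite !ffunE scalerDl scalerA.
have ha z w (g : hom z w) p : h w (act (submodule (sieve_submod S)) g p) = act V g (h z p).
  rewrite /h linear_sum.
  rewrite [RHS](partition_big (fun f => hcomp g f) xpredT) //=; apply: eq_bigr => k _.
  rewrite ffunE scaler_suml; apply: eq_bigr => f /eqP <-; rewrite linearZ /=.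
  have [->|pf] := eqVneq (val p f) 0; first by rewrite !scale0r.
  have Sf : S z f by have := valP p; rewrite inE; apply.
  have Sgf : S w (@hcomp C _ _ _ f g) by exact: sv_comp.
  by rewrite (s'E z f Sf) -[act V g _]/(restr (underlying_presheaf V) g _) -ms -(s'E _ _ Sgf).
have [q qE] := iQ _ _ _ (mcomp j (MHom hl ha)) (@submod_incl_inj _ _ _ (sieve_submod S)).
have qs z f (Sf : S z f) : 
    act Q (f : hom x z) (q x (repr_basis R (@idm (op C) x))) = j z (s z f Sf).
  rewrite -mfun_act repr_basis_act.
  have [p ep] : exists p, submod_incl (sieve_submod S) z p = repr_basis R (f : hom x z).
    apply: submod_mem => g; rewrite ffunE.
    by have [<-//|] := eqVneq (f : hom x z) g; rewrite eqxx.
  rewrite [X in repr_basis R X]hcompm1 -ep [LHS](mhom_eqE qE p) /=; congr (j z _).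
  rewrite /h (_ : val p = repr_basis R (f : hom x z)) //.
  rewrite (bigD1 f) //= ffunE eqxx scale1r big1 ?addr0 ?(s'E z f Sf) //.
  by move=> g /negbTE gf; rewrite ffunE eq_sym gf scale0r.
have [a ea] := js _ _ (f0 : hom x y0) _ _ (qs _ _ Sf0).
exists a; split=> [z f Sf|b bE].
  by apply: ji; rewrite -qs -ea; exact: mfun_act.
have tV := torsion_free_sub ji tQ.
apply/eqP; rewrite -subr_eq0; apply/eqP; apply: (tV _ _ (f0 : hom x y0)).
rewrite linearB /=; apply/eqP; rewrite subr_eq0; apply/eqP.
have /= -> := bE _ _ Sf0.
by apply: ji; rewrite -qs -ea; exact: mfun_act.
Qed.
End AtomicSheaves.

(** * The Nakayama functor *)

Lemma mcomp_repr_expand (R : fieldType) (D : fincat) (X : dmod R D) (y z : D)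
    (d : mhom (repr_mod R z) (repr_mod R y)) (q : mhom X (repr_mod R z)) :
  mcomp d q = \sum_f (d z (repr_basis R (idm z)) f : R) *: mcomp (precomp R f) q.
Proof.
apply: mhomP => t v; rewrite mhom_sumE {1}[d]repr_mhom_expand /= mhom_sumE.
exact: eq_bigr.
Qed.

Lemma mcomp_dsum_expand (R : fieldType) (D : fincat) (I : finType)
    (Y : I -> dmod R D) (X W : dmod R D) (c : mhom (dsum Y) W) (q : mhom X (dsum Y)) :
  mcomp c q = \sum_i mcomp (mcomp c (dsum_in Y i)) (mcomp (dsum_pr Y i) q).
Proof. by apply: mhomP => t v; rewrite mhom_sumE [LHS]dsum_mhomE. Qed.

Section NakayamaFunctor.
Variables (R : fieldType) (D : fincat).
Local Notation P := (@repr_mod R D).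
Local Notation dmod := (dmod R D).
Local Notation nu := (@nakayama_mod R D).
Hypothesis typeD : typeII D.
Hypotheses (hLN : LN R D) (hLS : LS R D) (hNV : NV R D).

(** Both finiteness statements are inherited from Hom(V, P x). *)
Lemma nakayama_fd (V : dmod) : finitely_generated V -> finite_dimensional (nu V).
Proof.
move=> fV; split=> [|x]; last exact/finite_diml_dual/fg_hom_finite_diml.
apply: sub_finite_set (fg_hom_support (R := R) (typeII_finite typeD) fV) => x [l /eqP l0] /=.
apply: contrapT => h; apply: l0; apply: dualP => c.
have [->|c0] := eqVneq c 0; first by rewrite linear0.
by case: h; exists c.
Qed.

Lemma mhom_bijective_iso (V W : dmod) (u : mhom V W) :
  minjective u -> msurjective u -> @is_iso (Dmod R D) V W u.
Proof.
move=> ui us; have [|v uv] := mono_lift (g := mid W) ui; first by move=> x w; exact: us.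
exists v; split=> //; apply: mhomP => x w; apply: ui; exact: (mhom_eqE uv).
Qed.

Lemma nakayama_hom_inj (V W : dmod) (u : mhom V W) :
  (forall x (c : mhom V (P x)), exists d, mcomp d u = c) -> minjective (nakayama_hom u).
Proof.
move=> ext; apply: minjective0 => x l e; apply: dualP => c.
have [d <-] := ext x c; exact: (congr1 (fun k : dual _ => k d) e).
Qed.

(** P x is injective and torsion free, so Hom(-, P x) inverts s. *)
Lemma nakayama_torsion_iso (V W : dmod) (s : mhom V W) :
  torsion_iso s -> @is_iso (Dmod R D) _ _ (nakayama_hom s).
Proof.
move=> ts.
have tP x : torsion_free (P x) by apply: repr_torsion_free; exact: typeII_mono.
have ext x (c : mhom V (P x)) : exists d, mcomp d s = c.
  have sat : saturated (mid (P x)) by split=> [y v w|y z f q w _] //; exists q.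
  exact: (torsion_iso_lift (repr_injective hLS (x:=x)) (tP x) sat ts).
apply: mhom_bijective_iso; first exact: nakayama_hom_inj.
move=> x l.
have [||k kE] := @linear_factor _ _ _ _ (mcompr s : {linear mhom W (P x) -> mhom V (P x)}) l.
- exact: ext.
- move=> c e; rewrite (_ : c = 0) ?linear0 //.
  by apply: (torsion_iso_cancel (tP x) ts); rewrite [LHS]e; apply: mhomP.
by exists k; apply: dualP => c; exact: kE.
Qed.

(** Functionals on Hom(V, P x) separate the composites of u and v with
    the components of j. *)
Lemma nakayama_faithful (V W : dmod) (I : finType) (x : I -> D)
    (j : mhom W (dsum (fun i => P (x i)))) (u v : mhom V W) :
  finitely_generated V -> minjective j -> nakayama_hom u = nakayama_hom v -> u = v.
Proof.
move=> fV ji /mhom_eqE e; apply: mhomP => y w; apply: ji.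
apply: functional_extensionality_dep => i; set c := mcomp (dsum_pr _ i) j.
suff /mhom_eqE : mcomp c u = mcomp c v by apply.
apply/eqP; rewrite -subr_eq0; apply/eqP.
apply: (dual_separates0 (fg_hom_finite_diml _ fV)) => l.
rewrite linearB; apply/eqP; rewrite subr_eq0; apply/eqP.
exact: (congr1 (fun k : dual _ => k c) (e (x i) l)).
Qed.

(** By reflexivity phi is dual to a family psi of maps
    Hom(W, P y) -> Hom(V, P y), which commutes with all maps between sums of
    representables.  Applying psi to the components of j gives V -> Q. *)
Lemma nakayama_full (V W : dmod) (I : finType) (x : I -> D)
    (j : mhom W (dsum (fun i => P (x i)))) (phi : mhom (nu V) (nu W)) :
  finitely_generated V -> saturated j -> exists u : mhom V W, nakayama_hom u = phi.
Proof.
move=> fV js; set Q := dsum _ in j js *.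
have phil y (p : mhom W (P y)) : linear (fun l : dual (mhom V (P y)) => phi y l p : R^o).
  by move=> a l k; rewrite linearP.
pose psi y (p : mhom W (P y)) := projT1 (cid
  (dual_reflexive (linear_of (phil y p)) (fg_hom_finite_diml y fV))).
have psiE y p (l : dual (mhom V (P y))) : phi y l p = l (psi y p).
  exact: (projT2 (cid (dual_reflexive (linear_of (phil y p)) (fg_hom_finite_diml y fV)))).
have psi_uniq y p (c : mhom V (P y)) : (forall l : dual _, phi y l p = l c) -> psi y p = c.
  move=> h; apply/eqP; rewrite -subr_eq0; apply/eqP.
  apply: (dual_separates0 (fg_hom_finite_diml _ fV)) => l.
  by rewrite linearB -psiE h subrr.
have psil y : linear (psi y).
  move=> a p q; apply: psi_uniq => l; rewrite [LHS]linearP.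
  by rewrite [RHS]linearP -!psiE.
have psi_precomp y z (f : hom y z) (p : mhom W (P z)) :
    psi y (mcomp (precomp R f) p) = mcomp (precomp R f) (psi z p).
  apply: psi_uniq => l.
  have := congr1 (fun k : dual _ => k p) (mfun_act phi f l).
  by rewrite /= psiE => <-; exact: psiE.
have psi_comp y z (d : mhom (P z) (P y)) p : psi y (mcomp d p) = mcomp d (psi z p).
  pose L := linear_of (psil y).
  rewrite !mcomp_repr_expand -[psi y]/(L : _ -> _) linear_sum; apply: eq_bigr => f _.
  by rewrite linearZ /= psi_precomp.
pose u := dsum_pair (fun i => psi (x i) (mcomp (dsum_pr _ i) j)) : mhom V Q.
have psi_u y (c : mhom Q (P y)) : psi y (mcomp c j) = mcomp c u.
  rewrite !mcomp_dsum_expand -[psi y]/(linear_of (psil y) : _ -> _) linear_sum.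
  apply: eq_bigr => i _ /=; by rewrite psi_comp; congr mcomp; apply: mhomP.
have psi0 y : psi y 0 = 0 by exact: (linear0 (linear_of (psil y))).
(* A map c that vanishes on W also vanishes on the image of u, since psi sends
   the composite of c and j to that of c and u. *)
have [|w wE] := mono_lift (g := u) js.1.
  move=> y v; apply: (saturated_cogenerated hLN hLS hNV (dsum_repr_fg _ _) js) => z c cj.
  by rewrite -[LHS]/(mcomp c u y v) -psi_u cj psi0.
exists w; apply: mhomP => y l; apply: dualP => p.
(* Every map p on W extends to Q, where psi is known. *)
have [|c cE] := injective_factor (f := p) (repr_injective hLS (x:=y)) (u := j).
  by move=> z v jv; rewrite (_ : v = 0) ?linear0 //; apply: (js.1 z); rewrite linear0.
rewrite [RHS]psiE -cE psi_u -wE.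
by rewrite /= /mcompr; congr (l _); apply: mhomP.
Qed.

(** Finitely many functionals span the duals of all M x: if they vanish on the
    translates of m, so do all functionals, and m itself is a translate. *)
Lemma fd_cogenerated (M : dmod) : finite_dimensional M ->
  exists (I : finType) (x : I -> D) (l : forall i, dual (M (x i))),
    forall y (m : M y), (forall i (f : hom y (x i)), l i (act M f m) = 0) -> m = 0.
Proof.
move=> [sM fM].
have sdM : finite_set [set x | exists l : dual (M x), l != 0]%classic.
  apply: sub_finite_set sM => x [l /eqP l0] /=.
  apply: contrapT => h; apply: l0; apply: dualP => m.
  have [->|m0] := eqVneq m 0; first by rewrite linear0.
  by case: h; exists m.
have [I [x [l [_ lN]]]] := finite_span
  (fun x => @Subspace R (dual (M x)) setT I (fun _ _ _ _ _ => I)) sdM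
  (fun x => finite_diml_dual (fM x)).
exists I, x, l => y m lm; apply: (dual_separates0 (fM y)) => k.
have Z0 z f : (0 : dual (M z)) (act M (f : hom y z) m) = 0 by [].
have ZL z a (c d : dual (M z)) :
    (forall f : hom y z, c (act M f m) = 0) -> (forall f : hom y z, d (act M f m) = 0) ->
    forall f : hom y z, (a *: c + d) (act M f m) = 0.
  move=> hc hd f; transitivity (a *: (c (act M f m) : R^o) + d (act M f m)); first by [].
  by rewrite hc hd scaler0 addr0.
have := lN (fun z => @Subspace R _
  [set c : dual (M z) | forall f : hom y z, c (act M f m) = 0]%classic (Z0 z) (ZL z)).
by move=> /(_ lm y k Logic.I (idm y)); rewrite act1.
Qed.

Section EssentialSurjectivity.
Variables (M : dmod) (I : finType) (x : I -> D) (l : forall i, dual (M (x i))).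
Hypothesis fM : forall y, finite_diml (M y).
Hypothesis l_detects :
  forall y (m : M y), (forall i (f : hom y (x i)), l i (act M f m) = 0) -> m = 0.
Local Notation Q := (dsum (fun i => P (x i))).

Definition coefficient (i : I) (y : D) (c : mhom Q (P y)) : P y (x i) :=
  c _ (dsum_in (fun i => P (x i)) i _ (repr_basis R (idm (x i)))).

(** Each functional l i on M (x i) gives a map from M to nu (P (x i)); this is
    their sum, written without identifying the nu of a sum of representables. *)
Definition pairing (y : D) (m : M y) (c : mhom Q (P y)) : R^o :=
  \sum_i l i (yoneda m _ (coefficient i c)).

Lemma yoneda_vector_linear y z (p : P y z) : linear (fun m : M y => yoneda m z p).
Proof.
move=> a m n; rewrite /= /yoneda_fun scaler_sumr -big_split; apply: eq_bigr => f _ /=.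
by rewrite linearP scalerDr !scalerA mulrC.
Qed.

Lemma pairing_linear y (m : M y) : linear (pairing m).
Proof.
move=> a c d; rewrite /pairing scaler_sumr -big_split; apply: eq_bigr => i _.
by rewrite [coefficient i _](_ : _ = a *: coefficient i c + coefficient i d) // !linearP.
Qed.

Lemma pairing_vector_linear y :
  linear (fun m : M y => linear_of (pairing_linear m) : dual (mhom Q (P y))).
Proof.
move=> a m n; apply: dualP => c.
transitivity (a *: pairing m c + pairing n c); last by [].
rewrite [LHS]/(pairing (a *: m + n) c) /pairing scaler_sumr -big_split.
by apply: eq_bigr => i _; rewrite yoneda_vector_linear linearP.
Qed.

Lemma pairing_precomp y z (f : hom y z) (m : M y) (c : mhom Q (P z)) :
  pairing m (mcomp (precomp R f) c) = pairing (act M f m) c.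
Proof.
apply: eq_bigr => i _; congr (l i _).
suff /mhom_eqE : mcomp (yoneda m) (precomp R f) = yoneda (act M f m) by apply.
apply: repr_mhomP; rewrite [RHS]yoneda_idm.
have e : precomp R f z (repr_basis R (idm z)) = repr_basis R f by rewrite precomp_basis hcomp1m.
exact: etrans (congr1 (yoneda m z) e) (yoneda_basis _ _).
Qed.

Definition to_nakayama : mhom M (nu Q).
Proof.
refine (@MHom R D M (nu Q) (fun y m => linear_of (pairing_linear m)) pairing_vector_linear _).
by move=> y z f m; apply: dualP => c; exact: esym (pairing_precomp _ _ _).
Defined.

(** Evaluate at the map from Q to P y that is the projection to P (x i)
    followed by precomposition with f: this recovers l i (act M f m). *)
Lemma to_nakayama_inj : minjective to_nakayama.
Proof.
apply: minjective0 => y m e; apply: l_detects => i f.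
pose c := mcomp (precomp R f) (dsum_pr (fun i => P (x i)) i).
have ci : coefficient i c = repr_basis R f.
  apply: etrans (congr1 (precomp R f (x i)) (dsum_prK _)) _.
  by rewrite precomp_basis hcomp1m.
have ck k : k != i -> coefficient k c = 0.
  move=> ki; exact: etrans (congr1 (precomp R f (x k)) (dsum_pr_in _ ki)) (linear0 _).
transitivity (pairing m c); last exact: (congr1 (fun k : dual _ => k c) e).
rewrite /pairing (bigD1 i) // big1 => [|k ki]; first by rewrite ci yoneda_basis [RHS]addr0.
by rewrite ck // !linear0.
Qed.

(** The annihilator of M in Hom(Q, P y). *)
Definition perp_subspace (y : D) : subspace (mhom Q (P y)).
Proof.
refine (@Subspace R _ [set c | forall m, pairing (y := y) m c = 0]%classic _ _).
- by move=> m; exact: (linear0 (linear_of (pairing_linear m))).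
- by move=> a c d hc hd m; rewrite pairing_linear hc hd scaler0 addr0.
Defined.

(** The common kernel in Q of the annihilator of M. *)
Definition coperp_subspace (z : D) : subspace (Q z).
Proof.
refine (@Subspace R _
  [set q | forall y c, ss_set (perp_subspace y) c -> c z q = 0]%classic _ _).
- by move=> y c _; rewrite linear0.
- by move=> a p q hp hq y c hc; rewrite linearP /= hp ?hq ?scaler0 ?addr0.
Defined.

Definition coperp : submod Q.
Proof.
refine (@Submod R D Q coperp_subspace _) => y z f q h t c hc.
by rewrite mfun_act h ?linear0.
Defined.

Lemma coperp_saturated : saturated (submod_incl coperp).
Proof.
split=> [|y z f q w e]; first exact: submod_incl_inj.
apply: submod_mem => t c hc.
apply: (repr_torsion_free (typeII_mono typeD) (f := f)).
by rewrite -mfun_act e; exact: (submod_memP w).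
Qed.

(** Finitely many elements e k of the annihilator have the same common kernel,
    so c factors through the map they define from Q to a sum of
    representables; hence it is a combination of precompositions applied to the
    e k, which stay in the annihilator. *)
Lemma coperp_perp y (c : mhom Q (P y)) :
  mcomp c (submod_incl coperp) = 0 -> ss_set (perp_subspace y) c.
Proof.
move=> /mhom_eqE c0 m.
have [K [z [e [eN eK]]]] :=
  fg_jointly_spanning typeD perp_subspace (dsum_repr_fg R x).
have [|d <-] := injective_factor (u := dsum_pair e) (f := c) (repr_injective hLS (x:=y)).
  move=> t q q0; have [|w <-] := @submod_mem _ _ _ coperp t q; last exact: c0.
  move=> t' c' hc'; apply: (eK t q _ t' c' hc') => i.
  exact: (congr1 (fun w : dsum (fun i => P (z i)) t => w i) q0).
pose L := linear_of (pairing_linear m).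
rewrite mcomp_dsum_expand -[pairing m _]/(L _) linear_sum big1 // => k _.
rewrite mcomp_repr_expand linear_sum big1 // => f _; rewrite linearZ /=.
rewrite pairing_precomp (_ : mcomp _ _ = e k); last exact: mhomP.
by rewrite eN scaler0.
Qed.

(** Both modules sit in nu Q.  Maps that vanish on the common kernel annihilate
    M, so M lies in the image of nu j.  Conversely a functional of the form nu j k vanishes on
    the annihilator of M, hence it lies in M by separation and reflexivity. *)
Lemma to_nakayama_coperp :
  exists h : mhom M (nu (submodule coperp)), @is_iso (Dmod R D) _ _ h.
Proof.
pose j := submod_incl coperp; pose nj := nakayama_hom j.
have ext y (c : mhom (submodule coperp) (P y)) : exists d, mcomp d j = c.
  exact: (repr_injective hLS c (@submod_incl_inj _ _ _ coperp)).
have nj_inj : minjective nj by exact: nakayama_hom_inj.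
have [|h hE] := mono_lift (g := to_nakayama) nj_inj.
  move=> y m.
  have [||k kE] := @linear_factor _ _ _ _
    (mcompr j : {linear mhom Q (P y) -> mhom (submodule coperp) (P y)})
    (to_nakayama y m).
  - exact: ext.
  - by move=> c c0; exact: (coperp_perp c0).
  by exists k; apply: dualP => c; exact: kE.
exists h; apply: mhom_bijective_iso.
  move=> y m n e; apply: to_nakayama_inj.
  by rewrite -!(mhom_eqE hE) /= e.
move=> y k.
have : ss_set (image_subspace to_nakayama y) (nj y k).
  apply: dual_separates => [|F hF].
    exact/finite_diml_dual/fg_hom_finite_diml/dsum_repr_fg.
  have [c cE] := dual_reflexive F (fg_hom_finite_diml y (dsum_repr_fg R x)).
  rewrite cE; transitivity (k (mcomp c j)); first by [].
  rewrite (_ : mcomp c j = 0) ?linear0 //; apply: mhomP => z q.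
  apply: (submod_memP q) => m.
  by rewrite -[LHS](cE (to_nakayama y m)); apply: hF; exists m.
move=> [m em]; exists m; apply: nj_inj.
by rewrite -em; exact: (mhom_eqE hE).
Qed.
End EssentialSurjectivity.

Lemma nakayama_ess_surj (M : dmod) : finite_dimensional M ->
  exists (I : finType) (x : I -> D) (W : dmod) (j : mhom W (dsum (fun i => P (x i)))),
    [/\ finitely_generated W, saturated j
      & exists h : mhom M (nu W), @is_iso (Dmod R D) _ _ h].
Proof.
move=> fM; have [I [x [l detects]]] := fd_cogenerated fM.
exists I, x, (submodule (coperp l)), (submod_incl (coperp l)); split.
- exact/hLN/dsum_repr_fg.
- exact: coperp_saturated.
- exact: to_nakayama_coperp.
Qed.
End NakayamaFunctor.

(** * Equivalences and localizations of categories *)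

Section Equivalences.
Variables A B : category.

Definition full (F : functor A B) : Prop :=
  forall (x y : A) (g : arr (F x) (F y)), exists f : arr x y, fmap F f = g.

Definition faithful (F : functor A B) : Prop :=
  forall (x y : A) (f g : arr x y), fmap F f = fmap F g -> f = g.

Definition essentially_surjective (F : functor A B) : Prop :=
  forall y : B, exists (x : A) (a : arr (F x) y), is_iso a.

Lemma ff_es_equivalence (F : functor A B) :
  full F -> faithful F -> essentially_surjective F -> is_equivalence F.
Proof.
move=> fullF faithF esF.
pose G y := projT1 (cid (esF y)).
pose a y : arr (F (G y)) y := projT1 (cid (projT2 (cid (esF y)))).
have a_iso y : is_iso (a y) by exact: projT2 (cid (projT2 (cid (esF y)))).
pose b y := projT1 (cid (a_iso y)).
have ba y : b y \oc a y = ida _ by exact: (projT2 (cid (a_iso y))).1.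
have ab y : a y \oc b y = ida _ by exact: (projT2 (cid (a_iso y))).2.
pose Gm y z (g : arr y z) := projT1 (cid (fullF _ _ (b z \oc g \oc a y))).
have GmE y z (g : arr y z) : fmap F (Gm y z g) = b z \oc g \oc a y.
  exact: projT2 (cid (fullF _ _ (b z \oc g \oc a y))).
have Gm1 y : Gm y y (ida y) = ida (G y).
  by apply: faithF; rewrite GmE fmap1 acompm1 ba.
have GmM x y z (g : arr y z) (f : arr x y) : Gm x z (g \oc f) = Gm y z g \oc Gm x y f.
  apply: faithF; rewrite fmapM !GmE !acompA; congr (_ \oc _ \oc _).
  by rewrite -[_ \oc a y \oc _]acompA ab acompm1.
exists (@Functor B A G Gm Gm1 GmM); split.
  pose t x := projT1 (cid (fullF _ _ (a (F x)))).
  have tE x : fmap F (t x) = a (F x) by exact: projT2 (cid (fullF _ _ (a (F x)))).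
  exists t; split=> [x|x y f].
    have [s sE] := fullF _ _ (b (F x)).
    by exists s; split; apply: faithF; rewrite fmapM fmap1 tE sE; [exact: ba|exact: ab].
  apply: faithF => /=.
  by rewrite !fmapM !tE GmE !acompA ab acomp1m.
exists a; split=> [y|y z g] /=; first exact: a_iso.
by rewrite GmE !acompA ab acomp1m.
Qed.
End Equivalences.

(** Objects and morphisms of B are moved into the image of F along
    isomorphisms. *)
Lemma equivalence_cancel (A B E : category) (F : functor A B) (G : functor B E) :
  full F -> essentially_surjective F ->
  full (functor_comp G F) -> faithful (functor_comp G F) ->
  essentially_surjective (functor_comp G F) ->
  [/\ full G, faithful G & essentially_surjective G].
Proof.
move=> fullF esF fullGF faithGF esGF; split=> [x y h|x y h h' e|z].
- have [x' [a [a' [aa aa']]]] := esF x; have [y' [b [b' [bb bb']]]] := esF y.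
  have [f /= fE] := fullGF x' y' (fmap G b' \oc h \oc fmap G a).
  exists (b \oc fmap F f \oc a'); rewrite !fmapM fE !acompA -fmapM bb' fmap1.
  by rewrite acomp1m -acompA -fmapM aa' fmap1 acompm1.
- have [x' [a [a' [aa aa']]]] := esF x; have [y' [b [b' [bb bb']]]] := esF y.
  have [f fE] := fullF _ _ (b' \oc h \oc a); have [f' fE'] := fullF _ _ (b' \oc h' \oc a).
  have ff' : f = f' by apply: faithGF => /=; rewrite fE fE' !fmapM e.
  have conj k : k = b \oc (b' \oc k \oc a) \oc a'.
    by rewrite !acompA bb' acomp1m -acompA aa' acompm1.
  by rewrite (conj h) (conj h') -fE -fE' ff'.
- by have [x [a ia]] := esGF z; exists (F x), a.
Qed.

Section Localization.
Variables (A : category) (W : calculus A).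

(** The inverse is the fraction with denominator s and numerator the
    identity. *)
Lemma loc_map_iso (X Y : A) (s : arr X Y) : weak W s ->
  @is_iso (fractions W) X Y (loc_map W s).
Proof.
move=> ws; exists (frac (Roof (ida X) ws)); rewrite /= /loc_map !frac_compE.
split; apply/frac_eqP; rewrite /roof_comp.
  case: (weak_square _ _) => U p p' wp /= e.
  have [T [t [wt et]]] := weak_cancel ws e.
  exists T, t, (p \oc t); rewrite /= !acomp1m et; split=> //.
  by rewrite -et; exact: weak_comp.
case: (weak_square _ _) => U p p' wp /=; rewrite !acomp1m => e.
exists U, (ida U), (s \oc p); rewrite /= !acompm1 !acomp1m e; split=> //.
by rewrite -e; exact: weak_comp.
Qed.

Variables (B : category) (F : functor A B).
Hypothesis F_iso : forall (X Y : A) (s : arr X Y), weak W s -> is_iso (fmap F s).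

Lemma inverted_epi (X Y : A) (s : arr X Y) Z (g h : arr (F Y) Z) : weak W s ->
  g \oc fmap F s = h \oc fmap F s -> g = h.
Proof.
move=> /F_iso [t [_ st]] e.
by rewrite -[g]acompm1 -[h]acompm1 -st !acompA e.
Qed.

Definition roof_map X Y (r : roof W X Y) : arr (F X) (F Y) :=
  fmap F (num r) \oc projT1 (cid (F_iso (den_weak r))).

Lemma roof_mapE X Y (r : roof W X Y) : roof_map r \oc fmap F (den r) = fmap F (num r).
Proof. by rewrite /roof_map -acompA (projT2 (cid (F_iso (den_weak r)))).1 acompm1. Qed.

Lemma roof_map_eqv X Y (r r' : roof W X Y) : roof_eqv r r' -> roof_map r = roof_map r'.
Proof.
move=> [T [a [b [e1 e2 w]]]]; apply: (inverted_epi w).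
by rewrite {2}e1 !fmapM !acompA !roof_mapE -!fmapM e2.
Qed.

Lemma roof_map_comp X Y Z (q : roof W Y Z) (r : roof W X Y) :
  roof_map (roof_comp q r) = roof_map q \oc roof_map r.
Proof.
apply: (inverted_epi (den_weak (roof_comp q r))); rewrite roof_mapE /roof_comp /=.
case: (weak_square _ _) => U p p' wp /= e.
transitivity (roof_map q \oc (roof_map r \oc fmap F (den r)) \oc fmap F p).
  by rewrite roof_mapE -acompA -[fmap F (num r) \oc _]fmapM e fmapM fmapM acompA roof_mapE.
by rewrite fmapM !acompA.
Qed.

Definition frac_map X Y (E : frac_hom W X Y) : arr (F X) (F Y) := roof_map (frac_repr E).

Lemma frac_mapE X Y (r : roof W X Y) : frac_map (frac r) = roof_map r.
Proof. exact/roof_map_eqv/frac_reprE. Qed.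

Lemma frac_map_loc X Y (f : arr X Y) : frac_map (loc_map W f) = fmap F f.
Proof. by rewrite frac_mapE -[LHS]acompm1 -fmap1; exact: (roof_mapE (Roof f _)). Qed.

Lemma frac_map1 X : frac_map (frac (roof_id W X)) = ida (F X).
Proof. by rewrite -fmap1; exact: frac_map_loc. Qed.

Lemma frac_mapM X Y Z (G : frac_hom W Y Z) (E : frac_hom W X Y) :
  frac_map (frac_comp G E) = frac_map G \oc frac_map E.
Proof. by rewrite frac_mapE roof_map_comp. Qed.

Definition frac_functor : functor (fractions W) B :=
  @Functor (fractions W) B (fun X => F X) frac_map frac_map1 frac_mapM.

End Localization.

(** * The equivalences *)

Theorem theorem1p3 (R : fieldType) (char0 : ([pchar R] =i pred0)%R)
  (C : fincat) (hC : typeII (op C)) (ore : left_ore (op C))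
  (hLN : LN R (op C)) (hLS : LS R (op C)) (hNV : NV R (op C)) :
  exists (nu_fd : forall V : fgmod R (op C),
            finite_dimensional (nakayama R (op C) V))
         (nubar : functor (serre_quotient hLN) (fdmod R (op C))),
    let nu : functor (fgmod R (op C)) (fdmod R (op C)) := corestrict nu_fd in
    let sh_to_mod : functor (sh R (atomic_topology ore)) (fgmod R (op C)) :=
      sh_incl R (atomic_topology ore) in
    [/\ nat_iso (functor_comp nubar (quotient_functor hLN)) nu,
        is_equivalence nubar,
        is_equivalence (functor_comp (quotient_functor hLN) sh_to_mod)
      & is_equivalence (functor_comp nu sh_to_mod)].
Proof.
have nu_fd (V : fgmod R (op C)) : finite_dimensional (nakayama R (op C) V).
  exact: (nakayama_fd hC (proj2_sig V)).
pose nu : functor (fgmod R (op C)) (fdmod R (op C)) := corestrict nu_fd.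
have nu_iso (V W : fgmod R (op C)) (s : arr V W) :
    weak (torsion_calculus hLN) s -> is_iso (fmap nu s).
  exact: (nakayama_torsion_iso hC hLS).
pose nubar := frac_functor nu_iso.
pose i := sh_incl R (atomic_topology ore).
have Qinj (I : finType) (x : I -> op C) := @dsum_repr_injective R (op C) hLS I x.
have Qtf (I : finType) (x : I -> op C) := @dsum_repr_torsion_free R (op C) hC I x.
have sh_sat (V : sh R (atomic_topology ore)) : exists (I : finType) (x : I -> op C)
    (j : mhom (sval (sval V)) (dsum (fun k => repr_mod R (x k)))), saturated j.
  case: V => -[V fV] /= shV.
  have [I [x [j ji]]] := fg_torsion_free_embeds hC hLN hLS hNV fV (sheaf_torsion_free shV).
  exists I, x, j; exact: (sheaf_saturated (Qtf I x) ji shV).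
have sat_sh (V : dmod R (op C)) (I : finType) (x : I -> op C)
    (j : mhom V (dsum (fun k => repr_mod R (x k)))) :
    saturated j -> sheaf (atomic_topology ore) (underlying_presheaf V).
  exact: (saturated_sheaf (Qinj I x) (Qtf I x)).
(* A roof ending at a sheaf is a genuine morphism: its numerator extends along
   its denominator. *)
have q_full : full (functor_comp (quotient_functor hLN) i).
  move=> V W E; have [I [x [j js]]] := sh_sat W.
  rewrite -[E]frac_reprK; case: (frac_repr E) => T d n wd.
  have [u uE] := torsion_iso_lift (Qinj I x) (Qtf I x) js wd n.
  exists u; apply/frac_eqP => /=.
  exists T, d, (ida T); split; [exact: mhomP|rewrite [LHS]uE; exact: mhomP|exact: wd].
have q_faithful : faithful (functor_comp (quotient_functor hLN) i).
  move=> V W f g /frac_eqP [T [a [b /= [e1 e2 wa]]]].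
  have [I [x [j js]]] := sh_sat W.
  have wa' : torsion_iso (a : mhom (sval T) (sval (sval V))) by exact: wa.
  have ab : a = b by apply: mhomP; exact: (mhom_eqE e1).
  by apply: (torsion_iso_cancel (torsion_free_sub js.1 (Qtf I x)) wa'); rewrite [LHS]e2 ab.
(* The torsion isomorphism from V to its saturation in Q is inverted. *)
have q_es : essentially_surjective (functor_comp (quotient_functor hLN) i).
  move=> V; have [I [x [j jt]]] := fg_torsion_kernel hC hLN hLS hNV (proj2_sig V).
  have [s [sE st]] := saturation_torsion_iso ore jt.
  pose S := fg_submodule hLN (V := exist _ _ (dsum_repr_fg R x)) (saturation ore j).
  have shS := sat_sh _ _ _ _ (saturation_saturated ore j).
  have [t [ts st']] := @loc_map_iso _ (torsion_calculus hLN) V S s st.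
  exists (exist _ S shS), t.
  by exists (@loc_map _ (torsion_calculus hLN) V S s).
have n_full : full (functor_comp nu i).
  move=> V W phi; have [I [x [j js]]] := sh_sat W.
  exact: (nakayama_full hLN hLS hNV phi (proj2_sig (sval V)) js).
have n_faithful : faithful (functor_comp nu i).
  move=> V W f g; have [I [x [j js]]] := sh_sat W.
  exact: (nakayama_faithful (proj2_sig (sval V)) js.1).
have n_es : essentially_surjective (functor_comp nu i).
  move=> [M fM]; have [I [x [W [j [fW js [h [h' [hh hh']]]]]]]] :=
    nakayama_ess_surj hC hLN hLS fM.
  by exists (exist _ (exist _ W fW) (sat_sh _ _ _ _ js)), h'; exists h.
(* On sheaves, nubar after the quotient functor is nu, so the equivalence of
   nubar follows from the two others by cancellation. *)
exists nu_fd, nubar; split.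
- exists (fun X => ida _); split=> [X|X Y f].
    by exists (ida _); rewrite acomp1m.
  by apply: etrans (acomp1m _) (etrans (frac_map_loc nu_iso f) (esym (acompm1 _))).
- have [] := @equivalence_cancel _ _ _ (functor_comp (quotient_functor hLN) i) nubar
    q_full q_es.
  + move=> V W phi; have [f fE] := n_full V W phi.
    by exists f; rewrite -fE; exact: (frac_map_loc nu_iso).
  + move=> V W f g e; apply: n_faithful.
    by rewrite -[LHS](frac_map_loc nu_iso) -[RHS](frac_map_loc nu_iso).
  + exact: n_es.
  exact: ff_es_equivalence.
- exact: ff_es_equivalence.
- exact: ff_es_equivalence.
Qed.
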